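(* Let $(X_i,Z_i)_{i\ge1}$ be i.i.d. with joint distribution $P_{XZ}$ on finite alphabets $\mathcal{X}\times\mathcal{Z}$, and let $D:\mathcal{X}\times\mathcal{X}\to[0,d_{\max}]$, $d_{\max}<\infty$. When unlimited common randomness is available ($R_0=\infty$), the rate-distortion-perception function with respect to the strong perceptual constraint satisfies \[ R^{(s)}(\Delta,\Pi)\le \inf_{\substack{P_{Y|XZ}:\ \mathbb{E}[D(X,Y)]\le\Delta\\ \limsup_{n\to\infty} d_{\mathrm{TV}}(\prod_{i=1}^nP_X,\prod_{i=1}^nP_Y)\le\Pi}} I(X;Y|Z), \] where the infimum is over conditional distributions of $Y\in\mathcal{X}$ given $(X,Z)\sim P_{XZ}$; moreover, the bound holds with equality when the codes are restricted so that the output sequence $Y^n=g_n(f_n(X^n,Z^n,K),Z^n,K)$ and the side information $Z^n$ are jointly i.i.d.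
   Context: $d_{\mathrm{TV}}(P,Q)=\sup_A|P(A)-Q(A)|$; $\prod_{i=1}^nP_X$ denotes the $n$-fold product of the marginal $P_X$; $D(x^n,y^n)=\frac1n\sum_iD(x_i,y_i)$; $[m]=\{1,\dots,\lfloor m\rfloor\}$. An $(n,2^{nR},2^{nR_0})$ code consists of a (possibly stochastic) encoder $f_n:\mathcal{X}^n\times\mathcal{Z}^n\times[2^{nR_0}]\to[2^{nR}]$ and a (possibly stochastic) decoder $g_n:[2^{nR}]\times\mathcal{Z}^n\times[2^{nR_0}]\to\mathcal{X}^n$, with common randomness $K$ uniform on $[2^{nR_0}]$ independent of $(X^n,Z^n)$ and output $Y^n=g_n(f_n(X^n,Z^n,K),Z^n,K)$. $(R,R_0,\Delta,\Pi)$ is achievable with respect to strong perception if for every $\epsilon>0$ there is a sequence of $(n,2^{n(R+\epsilon)},2^{n(R_0+\epsilon)})$ codes with $\mathbb{E}[D(X^n,Y^n)]\le\Delta+\epsilon$ and $d_{\mathrm{TV}}(P_{X^n},P_{Y^n})\le\Pi+\epsilon$. $R^{(s)}(\Delta,\Pi)$ with $R_0=\infty$ denotes the infimum of rates $R$ such that $(R,R_0,\Delta,\Pi)$ is achievable with respect to strong perception for some (arbitrarily large) $R_0$. *)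

(* Defs.v *)
From HB Require Import structures.
From mathcomp Require Import all_boot all_order all_algebra.
From mathcomp Require Import all_classical all_reals all_analysis.
Set Implicit Arguments. Unset Strict Implicit. Unset Printing Implicit Defensive.
Import Order.TTheory GRing.Theory Num.Theory.
Local Open Scope ring_scope.

Section Defs.
Variable R : realType.

Definition is_pmf (T : finType) (p : T -> R) : Prop :=
  (forall t, 0 <= p t) /\ \sum_t p t = 1.

Definition prod_pmf (T : finType) (p : T -> R) (n : nat)
  (x : {ffun 'I_n -> T}) : R := \prod_(i < n) p (x i).

Definition dTV (T : finType) (p q : T -> R) : R :=
  \big[Num.max/0]_(A : {set T}) `| \sum_(t in A) p t - \sum_(t in A) q t |.

Definition log2 (x : R) : R := ln x / ln 2.

Definition card_rate (n : nat) (r : R) : nat := Num.truncn (2 `^ (n%:R * r)).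

Variables (X Z : finType).

Definition margX (PXZ : X * Z -> R) (x : X) : R := \sum_(z : Z) PXZ (x, z).

(* stochastic encoder / decoder, as transition probabilities *)
Definition encoder (n M M0 : nat) :=
  {ffun 'I_n -> X} -> {ffun 'I_n -> Z} -> 'I_M0 -> 'I_M -> R.
Definition decoder (n M M0 : nat) :=
  'I_M -> {ffun 'I_n -> Z} -> 'I_M0 -> {ffun 'I_n -> X} -> R.

Definition valid_code n M M0 (f : encoder n M M0) (g : decoder n M M0) : Prop :=
  (forall x z k, is_pmf (f x z k)) /\ (forall m z k, is_pmf (g m z k)).

(* joint pmf of (X^n, Z^n, K, Y^n), K uniform on 'I_M0 independent of (X^n,Z^n) *)
Definition code_joint (PXZ : X * Z -> R) n M M0 (f : encoder n M M0)
  (g : decoder n M M0) (x : {ffun 'I_n -> X}) (z : {ffun 'I_n -> Z})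
  (k : 'I_M0) (y : {ffun 'I_n -> X}) : R :=
  (\prod_(i < n) PXZ (x i, z i)) * M0%:R^-1 * \sum_(m : 'I_M) f x z k m * g m z k y.

Definition out_dist (PXZ : X * Z -> R) n M M0 (f : encoder n M M0)
  (g : decoder n M M0) (y : {ffun 'I_n -> X}) : R :=
  \sum_(x : {ffun 'I_n -> X}) \sum_(z : {ffun 'I_n -> Z}) \sum_(k : 'I_M0)
     code_joint PXZ f g x z k y.

Definition YZ_dist (PXZ : X * Z -> R) n M M0 (f : encoder n M M0)
  (g : decoder n M M0) (y : {ffun 'I_n -> X}) (z : {ffun 'I_n -> Z}) : R :=
  \sum_(x : {ffun 'I_n -> X}) \sum_(k : 'I_M0) code_joint PXZ f g x z k y.

Definition exp_dist (PXZ : X * Z -> R) (D : X -> X -> R) n M M0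
  (f : encoder n M M0) (g : decoder n M M0) : R :=
  \sum_(x : {ffun 'I_n -> X}) \sum_(z : {ffun 'I_n -> Z}) \sum_(k : 'I_M0)
  \sum_(y : {ffun 'I_n -> X})
     code_joint PXZ f g x z k y * (n%:R^-1 * \sum_(i < n) D (x i) (y i)).

Definition code_iid (PXZ : X * Z -> R) n M M0 (f : encoder n M M0)
  (g : decoder n M M0) : Prop :=
  exists PYZ : X * Z -> R, is_pmf PYZ /\
    forall y z, YZ_dist PXZ f g y z = \prod_(i < n) PYZ (y i, z i).

Definition achievable (restr : bool) (PXZ : X * Z -> R) (D : X -> X -> R)
  (Rt R0 Delta Pi : R) : Prop :=
  forall eps : R, 0 < eps -> exists N : nat, forall n : nat, (N <= n)%N ->
    exists (f : encoder n (card_rate n (Rt + eps)) (card_rate n (R0 + eps)))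
           (g : decoder n (card_rate n (Rt + eps)) (card_rate n (R0 + eps))),
      [/\ valid_code f g, (restr -> code_iid PXZ f g),
          exp_dist PXZ D f g <= Delta + eps &
          dTV (prod_pmf (margX PXZ) (n:=n)) (out_dist PXZ f g) <= Pi + eps].

(* R^{(s)}(Delta, Pi) with R0 = infinity *)
Definition Rs (restr : bool) (PXZ : X * Z -> R) (D : X -> X -> R)
  (Delta Pi : R) : \bar R :=
  ereal_inf [set r%:E | r in
    [set Rt | exists R0 : R, 0 <= R0 /\ achievable restr PXZ D Rt R0 Delta Pi]].

Definition single_joint (PXZ : X * Z -> R) (W : X -> Z -> X -> R) x y z : R :=
  PXZ (x, z) * W x z y.

Definition margY (PXZ : X * Z -> R) (W : X -> Z -> X -> R) (y : X) : R :=
  \sum_(x : X) \sum_(z : Z) single_joint PXZ W x y z.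

Definition cond_mutinf (PXZ : X * Z -> R) (W : X -> Z -> X -> R) : R :=
  let p := single_joint PXZ W in
  let pz z := \sum_(x : X) \sum_(y : X) p x y z in
  let pxz x z := \sum_(y : X) p x y z in
  let pyz y z := \sum_(x : X) p x y z in
  \sum_(x : X) \sum_(y : X) \sum_(z : Z)
    (if p x y z == 0 then 0
     else p x y z * log2 (p x y z * pz z / (pxz x z * pyz y z))).

Definition single_exp_dist (PXZ : X * Z -> R) (W : X -> Z -> X -> R)
  (D : X -> X -> R) : R :=
  \sum_(x : X) \sum_(y : X) \sum_(z : Z) single_joint PXZ W x y z * D x y.

Definition RDP_single (PXZ : X * Z -> R) (D : X -> X -> R) (Delta Pi : R) : \bar R :=
  ereal_inf [set (cond_mutinf PXZ W)%:E | W in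
    [set W : X -> Z -> X -> R |
      [/\ forall x z, is_pmf (W x z),
          single_exp_dist PXZ W D <= Delta &
          limn_sup (fun n => dTV (prod_pmf (margX PXZ) (n:=n))
                                 (prod_pmf (margY PXZ W) (n:=n))) <= Pi]]].

End Defs.

(* Main.v *)
Require Import Defs.
From HB Require Import structures.
From mathcomp Require Import all_boot all_order all_algebra.
From mathcomp Require Import all_classical all_reals all_analysis.
From mathcomp Require Import ring lra.
Import Order.TTheory GRing.Theory Num.Theory.
Import numFieldNormedType.Exports.
Local Open Scope ring_scope.

(** Achievability.  Given [z^n], draw [M] codewords i.i.d. from the law of [Y^n]
    given [z^n], and let the encoder pick codeword [m] with probability
    proportional to the likelihood ratio [r(x^n, y_m) = W(y_m|x^n,z^n) / Q(y_m|z^n)].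
    By convexity of [1/t] the law of the selected codeword, averaged over the
    codebook, is at least [W * M / (M + r)], so it is close to [W] as soon as
    [E (r / (M + r))] is small; a moment bound makes this expectation
    exponentially small when the rate exceeds [I(X;Y|Z)].  Exponentially many
    independent codebooks, indexed by [K], make the output law close to [Q] by a
    variance bound, hence some deterministic family is good.  The decoder finally
    corrects its output with the maximal coupling, using local randomness, so that
    [(Y^n, Z^n)] becomes exactly i.i.d. at a negligible cost in distortion.

    Converse.  For a posterior kernel [V(x|y,z)] put
    [U = prod_i V(X_i|Y_i,Z_i) / P(X_i|Z_i)].  Since the encoder probabilities are
    at most 1, [E U <= M], so [E ln U <= ln M] by Jensen.  The left-hand side is
    [n] times a linear functional of the time-averaged joint law of [(X_i,Y_i,Z_i)],
    which is a single-letter law with the [(Y,Z)]-marginal of the code.  Linearity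
    makes the passage to a limit point of these laws immediate, total variation
    between product laws being nondecreasing in [n]; the supremum over [V] of the
    limiting functional is [I(X;Y|Z)]. *)

(** * Finite probability *)

Section FinitePmf.
Context {R : realType}.

Lemma pmf_pos {T : finType} (p : T -> R) : is_pmf p -> exists t, 0 < p t.
Proof.
case=> p0 p1; apply: contrapT => np.
have : \sum_t p t = 0.
  apply: big1 => t _; apply/eqP; rewrite eq_le p0 andbT leNgt.
  by apply/negP => pt; apply: np; exists t.
by rewrite p1 => /eqP; rewrite oner_eq0.
Qed.

Lemma pmf_le1 {T : finType} (p : T -> R) t : is_pmf p -> p t <= 1.
Proof.
move=> [p0 <-]; rewrite (bigD1 t) //= lerDl; exact: sumr_ge0.
Qed.

(** The random-coding principle: a bound on the mean over random codebooks yields one deterministic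
    choice that meets it. *)
Lemma pmf_average_witness {T : finType} (p F : T -> R) b :
  is_pmf p -> \sum_t p t * F t <= b -> exists t, F t <= b.
Proof.
move=> pP le_b; apply: contrapT => nF.
have Fb t : b < F t by rewrite ltNge; apply/negP => Ft; apply: nF; exists t.
have [t0 pt0] := pmf_pos _ pP.
suff : b < b by rewrite ltxx.
apply: lt_le_trans le_b; have [p0 p1] := pP.
rewrite -[ltLHS]mul1r -p1 mulr_suml (bigD1 t0) //= [ltRHS](bigD1 t0) //=.
apply: ltr_leD; first by rewrite ltr_pM2l.
by apply: ler_sum => t _; apply: ler_wpM2l => //; exact: ltW.
Qed.

Lemma pmf_ffun {I T : finType} (p : I -> T -> R) :
  (forall i, is_pmf (p i)) ->
  is_pmf (fun x : {ffun I -> T} => \prod_i p i (x i)).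
Proof.
move=> pP; split=> [x|].
  by apply: prodr_ge0 => i _; case: (pP i).
by rewrite -(bigA_distr_bigA p) big1 // => i _; case: (pP i).
Qed.

Lemma prod_pmf_pmf {T : finType} (p : T -> R) n :
  is_pmf p -> is_pmf (prod_pmf p (n:=n)).
Proof. by move=> pP; exact: (pmf_ffun (fun=> p)). Qed.

Lemma sum2_prod {I A B : finType} (F : I -> A -> B -> R) :
  \sum_(x : {ffun I -> A}) \sum_(y : {ffun I -> B}) \prod_i F i (x i) (y i)
  = \prod_i \sum_a \sum_b F i a b.
Proof.
rewrite bigA_distr_bigA; apply: eq_bigr => x _.
by rewrite bigA_distr_bigA.
Qed.

Lemma sum3_prod {I A B C : finType} (F : I -> A -> B -> C -> R) :
  \sum_(x : {ffun I -> A}) \sum_(y : {ffun I -> B}) \sum_(z : {ffun I -> C})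
    \prod_i F i (x i) (y i) (z i)
  = \prod_i \sum_a \sum_b \sum_c F i a b c.
Proof.
rewrite bigA_distr_bigA; apply: eq_bigr => x _.
by rewrite -sum2_prod.
Qed.

Lemma sum_triple {A B C : finType} (F : A -> B -> C -> R) :
  \sum_(t : A * B * C) F t.1.1 t.1.2 t.2 = \sum_a \sum_b \sum_c F a b c.
Proof. by rewrite pair_big pair_big. Qed.

Lemma sum_indicator {T : finType} (F : T -> R) (t : T) :
  \sum_s (t == s)%:R * F s = F t.
Proof.
rewrite (bigD1 t) //= eqxx mul1r big1 ?addr0 // => s st.
by rewrite eq_sym (negbTE st) mul0r.
Qed.

(** Writes a function of one coordinate as a product over all coordinates, the form in which
    expectations under a product law factor. *)
Lemma prod_at {I : finType} (k : I) (F : I -> R) :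
  \prod_i (if i == k then F i else 1) = F k.
Proof. by rewrite -big_mkcond /= big_pred1_eq. Qed.

Lemma prod_pmf_expect {T : finType} (p : T -> R) n (g : 'I_n -> T -> R) :
  \sum_x prod_pmf p x * (\prod_i g i (x i)) = \prod_i \sum_t p t * g i t.
Proof.
by rewrite bigA_distr_bigA; apply: eq_bigr => x _; rewrite -big_split.
Qed.

Lemma prod_pmf_expect1 {T : finType} (p : T -> R) n k (h : T -> R) :
  is_pmf p -> \sum_x prod_pmf p (n:=n) x * h (x k) = \sum_t p t * h t.
Proof.
move=> [_ p1].
transitivity (\sum_x prod_pmf p (n:=n) x *
    \prod_i (if i == k then h (x i) else 1)).
  by apply: eq_bigr => x _; rewrite prod_at.
rewrite (prod_pmf_expect p n (fun i t => if i == k then h t else 1)) -[RHS](prod_at k (fun=> _)); apply: eq_bigr => i _.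
by case: eqP => // _; rewrite -[RHS]p1; apply: eq_bigr => t _; rewrite mulr1.
Qed.

Lemma prod_pmf_expect2 {T : finType} (p : T -> R) n k l (h h' : T -> R) :
  is_pmf p -> k != l ->
  \sum_x prod_pmf p (n:=n) x * (h (x k) * h' (x l))
  = (\sum_t p t * h t) * \sum_t p t * h' t.
Proof.
move=> [_ p1] kl.
transitivity (\sum_x prod_pmf p (n:=n) x * \prod_i
    ((if i == k then h (x i) else 1) * (if i == l then h' (x i) else 1))).
  by apply: eq_bigr => x _; rewrite big_split /= !prod_at.
rewrite (prod_pmf_expect p n (fun i t => (if i == k then h t else 1) *
  (if i == l then h' t else 1))).
rewrite -[X in X * _](prod_at k (fun=> _)).
rewrite -[X in _ * X](prod_at l (fun=> _)) -big_split; apply: eq_bigr => i _ /=.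
case: (eqVneq i k) => [->|ik].
  by rewrite (negbTE kl) mulr1; apply: eq_bigr => t _; rewrite mulr1.
case: eqP => _; first by rewrite mul1r; apply: eq_bigr => t _; rewrite mul1r.
by rewrite mulr1 -[RHS]p1; apply: eq_bigr => t _; rewrite !mulr1.
Qed.

Lemma sum_prod_pair_at {I A B : finType} (p : A -> B -> R) (k : I)
    (h : A -> B -> R) :
  \sum_a \sum_b p a b = 1 ->
  \sum_(x : {ffun I -> A}) \sum_(y : {ffun I -> B})
     (\prod_i p (x i) (y i)) * h (x k) (y k)
  = \sum_a \sum_b p a b * h a b.
Proof.
move=> p1.
transitivity (\sum_(x : {ffun I -> A}) \sum_(y : {ffun I -> B})
    \prod_i (p (x i) (y i) * (if i == k then h (x i) (y i) else 1))).
  apply: eq_bigr => x _; apply: eq_bigr => y _.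
  by rewrite big_split /= prod_at.
rewrite (sum2_prod (fun i a b => p a b * (if i == k then h a b else 1))).
rewrite -[RHS](prod_at k (fun=> _)); apply: eq_bigr => i _.
case: eqP => // _; rewrite -[RHS]p1.
by apply: eq_bigr => a _; apply: eq_bigr => b _; rewrite mulr1.
Qed.

(** Distinct coordinates are independent, so the variance of the empirical mean is at most
    [n%:R^-1]. The first absolute moment follows from [|v| <= (L * v ^+ 2 + L^-1) / 2], with [L]
    standing in for the square root of [n]. *)
Lemma abs_mean_deviation {T : finType} (p h : T -> R) n (L : R) :
  is_pmf p -> (forall t, 0 <= h t <= 1) -> 0 < L -> L ^+ 2 <= n%:R ->
  \sum_x prod_pmf p (n:=n) x *
     `| n%:R^-1 * (\sum_i h (x i)) - \sum_t p t * h t | <= L^-1.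
Proof.
move=> pP h01 L0 Ln; set m := \sum_t p t * h t.
have [p0 p1] := pP.
have m01 : 0 <= m <= 1.
  rewrite sumr_ge0 /= => [|t _]; last by rewrite mulr_ge0//; case/andP: (h01 t).
  rewrite -p1; apply: ler_sum => t _; rewrite -[leRHS]mulr1.
  by apply: ler_wpM2l => //; case/andP: (h01 t).
have n0 : (0 : R) < n%:R by apply: lt_le_trans Ln; rewrite exprn_gt0.
have [P0 P1] := prod_pmf_pmf p n pP.
pose u t := h t - m.
have Eu : \sum_t p t * u t = 0.
  under eq_bigr do rewrite mulrBr.
  by rewrite sumrB -mulr_suml p1 mul1r subrr.
have Var : \sum_x prod_pmf p (n:=n) x *
    (n%:R^-1 * (\sum_i h (x i)) - m) ^+ 2 <= n%:R^-1.
  have E (x : {ffun 'I_n -> T}) : (n%:R^-1 * (\sum_i h (x i)) - m) ^+ 2 =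
    n%:R^-1 ^+ 2 * \sum_i \sum_j u (x i) * u (x j).
    have -> : n%:R^-1 * (\sum_i h (x i)) - m = n%:R^-1 * \sum_i u (x i).
      rewrite sumrB sumr_const card_ord mulrBr -[m *+ n]mulr_natl mulrA.
      by rewrite mulVf ?mul1r // gt_eqF.
    rewrite exprMn; congr (_ * _); rewrite expr2 mulr_suml.
    by apply: eq_bigr => i _; rewrite mulr_sumr.
  under eq_bigr do rewrite E mulrCA.
  rewrite -mulr_sumr.
  under eq_bigr do rewrite mulr_sumr.
  rewrite exchange_big /=.
  have D (i : 'I_n) : \sum_x prod_pmf p (n:=n) x * (\sum_j u (x i) * u (x j)) <= 1.
    under eq_bigr do rewrite mulr_sumr.
    rewrite exchange_big /= (bigD1 i) //= [X in _ + X]big1 => [|j ji]; last first.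
      by rewrite prod_pmf_expect2 ?Eu ?mul0r // eq_sym.
    rewrite addr0 (prod_pmf_expect1 p n i (fun t => u t * u t)) // -p1.
    apply: ler_sum => t _; rewrite -[leRHS]mulr1; apply: ler_wpM2l => //.
    move: m01 (h01 t) => /andP[? ?] /andP[? ?]; rewrite /u; nra.
  apply: (@le_trans _ _ (n%:R^-1 ^+ 2 * n%:R)).
    apply: ler_wpM2l; first by rewrite exprn_ge0 // invr_ge0 ltW.
    apply: (@le_trans _ _ (\sum_(i < n) 1)); first exact: ler_sum.
    by rewrite sumr_const card_ord.
  by rewrite expr2 -mulrA mulVf ?mulr1 // gt_eqF.
have amgm (v : R) : `|v| <= (L * v ^+ 2 + L^-1) / 2.
  rewrite ler_pdivlMr // -(ler_pM2l L0) [leRHS]mulrDr mulfV ?gt_eqF //.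
  have -> : L * (L * v ^+ 2) = (L * `|v|) ^+ 2 by rewrite exprMn real_normK ?num_real // expr2; ring.
  have := sqr_ge0 (L * `|v| - 1); rewrite sqrrB1; nra.
apply: (@le_trans _ _ (\sum_x prod_pmf p (n:=n) x *
   ((L * (n%:R^-1 * (\sum_i h (x i)) - m) ^+ 2 + L^-1) / 2))).
  by apply: ler_sum => x _; apply: ler_wpM2l.
under eq_bigr do rewrite mulrA mulrDr mulrCA.
rewrite -mulr_suml big_split /= -mulr_sumr -mulr_suml P1 mul1r.
rewrite ler_pdivrMr // mulr_natr mulr2n lerD2r.
have := ler_wpM2l (ltW L0) Var => /le_trans; apply.
by rewrite ler_pdivrMr // mulrC ler_pdivlMr // -expr2.
Qed.

(** Both masses are 1, so the positive and negative parts of [p - q] have the same sum. *)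
Lemma sum_positive_parts {T : finType} (p q : T -> R) : is_pmf p -> is_pmf q ->
  \sum_t `|p t - q t| = 2 * \sum_t Num.max (p t - q t) 0.
Proof.
move=> [_ p1] [_ q1].
have E (v : R) : `|v| = 2 * Num.max v 0 - v.
  case: (lerP 0 v) => [v0|v0]; first by rewrite ger0_norm //; lra.
  by rewrite ltr0_norm //; lra.
under eq_bigr do rewrite E.
by rewrite sumrB sumrB p1 q1 subrr subr0 mulr_sumr.
Qed.

(* The maximal coupling of [p'] and [p], written as a channel applied to [p']. *)
Lemma coupling_channel {T : finType} (p' p : T -> R) : is_pmf p' -> is_pmf p ->
  exists K : T -> T -> R, [/\ forall t, is_pmf (K t),
    forall s, \sum_t p' t * K t s = p s &
    \sum_t p' t * (1 - K t t) <= \sum_t `|p' t - p t|].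
Proof.
move=> pP' pP; have [p0' p1'] := pP'; have [p0 p1] := pP.
pose d t := Num.max (p t - p' t) 0; pose d' t := Num.max (p' t - p t) 0.
pose S := \sum_t d t.
have SE : \sum_t d' t = S.
  have two : (2 : R) != 0 by rewrite pnatr_eq0.
  apply: (mulfI two); rewrite -!sum_positive_parts //.
  by apply: eq_bigr => t _; rewrite distrC.
have d0 t : 0 <= d t by rewrite le_max lexx orbT.
have d0' t : 0 <= d' t by rewrite le_max lexx orbT.
have S0 : 0 <= S by apply: sumr_ge0.
(* When [S = 0] the two laws coincide and the identity channel serves; otherwise the deficit [d] can
   be normalised by [S]. *)
have [SZ|SN] := eqVneq S 0.
  have dz t : d t = 0.
    apply/eqP; rewrite eq_le d0 andbT -SZ /S (bigD1 t) //= lerDl.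
    exact: sumr_ge0.
  have dz' t : d' t = 0.
    apply/eqP; rewrite eq_le d0' andbT -SZ -SE (bigD1 t) //= lerDl.
    exact: sumr_ge0.
  have E t : p' t = p t.
    have := dz t; have := dz' t; rewrite /d /d'.
    case: (lerP 0 (p t - p' t)); case: (lerP 0 (p' t - p t)) => *; lra.
  exists (fun t s => (t == s)%:R); split=> [t|s|].
  - split=> [s|]; first by rewrite ler0n.
    rewrite (bigD1 t) //= eqxx big1 ?addr0 // => s st.
    by rewrite eq_sym (negbTE st).
  - rewrite (bigD1 s) //= eqxx mulr1 E big1 ?addr0 // => t ts.
    by rewrite (negbTE ts) mulr0.
  - rewrite big1 => [|t _]; last by rewrite eqxx subrr mulr0.
    by apply: sumr_ge0.
have Sp : 0 < S by rewrite lt_neqAle eq_sym SN.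
(* The fraction of the mass at [t] that is in surplus. Where [p' t = 0] the quotient is 0 by
   convention, and the surplus [d' t] is 0 as well. *)
pose a t := d' t / p' t.
have aM t : p' t * a t = d' t.
  rewrite /a; case: (eqVneq (p' t) 0) => [z|nz]; last by rewrite mulrCA mulfV ?mulr1.
  rewrite z mul0r /d' z sub0r; case: lerP => // ?; have := p0 t => ?; lra.
have a01 t : 0 <= a t <= 1.
  rewrite divr_ge0 //= /a; have := p0' t; rewrite le_eqVlt => /predU1P[<-|pt].
    by rewrite invr0 mulr0.
  rewrite ler_pdivrMr // mul1r /d'; rewrite ge_max p0' andbT; have := p0 t; lra.
(* Keep [t] with probability [1 - a t], otherwise redraw from the normalised deficit. *)
exists (fun t s => (t == s)%:R * (1 - a t) + a t * (d s / S)); split=> [t|s|].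
- split=> [s|].
    case/andP: (a01 t) => a0 a1.
    by rewrite addr_ge0 // mulr_ge0 ?ler0n ?subr_ge0 // divr_ge0.
  rewrite big_split /= -mulr_suml -mulr_sumr -mulr_suml -/S divff // mulr1.
  rewrite (bigD1 t) //= eqxx big1 ?addr0 ?mul1r ?subrK // => s st.
  by rewrite eq_sym (negbTE st).
- under eq_bigr => t _ do rewrite mulrDr (mulrA (p' t) (a t)) aM.
  rewrite big_split /= -mulr_suml SE mulrCA divff // mulr1.
  rewrite (bigD1 s) //= eqxx mul1r big1 ?addr0 => [|t ts]; last first.
    by rewrite (negbTE ts) mul0r mulr0.
  rewrite mulrBr mulr1 aM /d /d'; case: lerP => ?; case: lerP => *; lra.
- apply: ler_sum => t _; rewrite eqxx mul1r.
  apply: (@le_trans _ _ (d' t)).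
    rewrite -aM; apply: ler_wpM2l => //.
    have : 0 <= a t * (d t / S) by rewrite mulr_ge0 ?divr_ge0 //; case/andP: (a01 t).
    lra.
  by rewrite ge_max ler_norm normr_ge0.
Qed.

End FinitePmf.

(** * One-shot coding *)

Section OneShot.
Context {R : realType} {A B : finType}.
Variables (p : A -> R) (w : A -> B -> R).
Hypotheses (pP : is_pmf p) (wP : forall a, is_pmf (w a)).

Definition output_pmf (b : B) : R := \sum_a p a * w a b.
Local Notation q := output_pmf.

(** The density of [w a] with respect to [q]; the convention for division makes it 0 off the support
    of [q]. *)
Definition likelihood (a : A) (b : B) : R := w a b / q b.
Local Notation r := likelihood.

Lemma output_pmf_pmf : is_pmf q.
Proof.
have [p0 p1] := pP; split=> [b|].
  by apply: sumr_ge0 => a _; apply: mulr_ge0 => //; case: (wP a).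
rewrite /q exchange_big -p1; apply: eq_bigr => a _ /=.
by rewrite -mulr_sumr; have [_ ->] := wP a; rewrite mulr1.
Qed.

Lemma likelihood_ge0 a b : 0 <= r a b.
Proof. by apply: divr_ge0; [case: (wP a)|case: output_pmf_pmf]. Qed.

Lemma output_pmf_gt0 a b : p a != 0 -> w a b != 0 -> 0 < q b.
Proof.
move=> pa wab; have [p0 _] := pP; have [w0 _] := wP a.
rewrite /q (bigD1 a) //= ltr_pwDl //; first by rewrite lt0r mulf_neq0 //= mulr_ge0.
by apply: sumr_ge0 => c _; apply: mulr_ge0 => //; case: (wP c).
Qed.

(** Only an inequality: mass that [w a] puts where [q] vanishes, which can happen when [p a = 0], is
    lost. *)
Lemma mean_likelihood_le1 a : \sum_b q b * r a b <= 1.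
Proof.
have [w0 <-] := wP a; apply: ler_sum => b _; rewrite /r.
have [->|qb] := eqVneq (q b) 0; first by rewrite mul0r.
by rewrite mulrCA divff ?mulr1.
Qed.

Section Codebook.
Variable M : nat.
Hypothesis M0 : (0 < M)%N.

Definition total_likelihood (c : {ffun 'I_M -> B}) a := \sum_m r a (c m).

(** When every codeword has likelihood 0 there is nothing to normalise; the uniform choice keeps the
    encoder a probability. *)
Definition likelihood_encoder (c : {ffun 'I_M -> B}) (a : A) (m : 'I_M) : R :=
  if total_likelihood c a == 0 then M%:R^-1
  else r a (c m) / total_likelihood c a.

Lemma likelihood_encoder_pmf c a : is_pmf (likelihood_encoder c a).
Proof.
have S0 : 0 <= total_likelihood c a.
  by apply: sumr_ge0 => m _; apply: likelihood_ge0.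
rewrite /likelihood_encoder; split=> [m|]; case: eqVneq => S.
- by rewrite invr_ge0 ler0n.
- by rewrite divr_ge0 ?likelihood_ge0.
- by rewrite sumr_const card_ord -[_ *+ _]mulr_natr mulVf // pnatr_eq0 -lt0n.
- by rewrite -mulr_suml divff.
Qed.

Definition codebook_channel (c : {ffun 'I_M -> B}) (a : A) (b : B) : R :=
  \sum_m likelihood_encoder c a m * (c m == b)%:R.

Lemma codebook_channel_pmf c a : is_pmf (codebook_channel c a).
Proof.
have [e0 e1] := likelihood_encoder_pmf c a; split=> [b|].
  by apply: sumr_ge0 => m _; rewrite mulr_ge0.
rewrite exchange_big -[RHS]e1; apply: eq_bigr => m _ /=.
rewrite -mulr_sumr (bigD1 (c m)) //= eqxx big1 ?addr0 ?mulr1 // => b bm.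
by rewrite eq_sym (negbTE bm).
Qed.

Definition mean_channel (a : A) (b : B) : R :=
  \sum_c prod_pmf q c * codebook_channel c a b.

Lemma mean_channel_pmf a : is_pmf (mean_channel a).
Proof.
have [P0 P1] := prod_pmf_pmf q M output_pmf_pmf; split=> [b|].
  by apply: sumr_ge0 => c _; apply: mulr_ge0 => //; case: (codebook_channel_pmf c a).
rewrite exchange_big -[RHS]P1; apply: eq_bigr => c _ /=.
by rewrite -mulr_sumr; have [_ ->] := codebook_channel_pmf c a; rewrite mulr1.
Qed.

(** Given [c m = b], the codeword [m] contributes [r a b], and the others are independent of it with
    mean likelihood at most 1 each. *)
Lemma tilted_total_likelihood_le a b (m : 'I_M) :
  \sum_c prod_pmf q c * ((c m == b)%:R * total_likelihood c a)
  <= q b * (r a b + M%:R).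
Proof.
have qP := output_pmf_pmf; have [q0 q1] := qP.
have ind_sum (h : B -> R) : \sum_t q t * ((t == b)%:R * h t) = q b * h b.
  rewrite (bigD1 b) //= eqxx mul1r big1 ?addr0 // => t tb.
  by rewrite (negbTE tb) mul0r mulr0.
under eq_bigr do rewrite mulr_sumr mulr_sumr.
rewrite exchange_big /= (bigD1 m) //= mulrDr.
apply: lerD.
  by rewrite (prod_pmf_expect1 q M m (fun t => (t == b)%:R * r a t)) // ind_sum.
apply: (@le_trans _ _ (\sum_(i < M | i != m) q b)).
  apply: ler_sum => i im.
  rewrite (prod_pmf_expect2 q M m i (fun t => (t == b)%:R) (r a)) //; last first.
    by rewrite eq_sym.
  have := ind_sum (fun=> 1); under eq_bigr do rewrite mulr1.
  move=> ->; rewrite mulr1 -[leRHS]mulr1.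
  by apply: ler_wpM2l => //; apply: mean_likelihood_le1.
rewrite mulr_natr -[X in _ *+ X]card_ord -sumr_const.
by rewrite [leRHS](bigD1 m) //= lerDr.
Qed.

(** Jensen's inequality for the inverse, conditionally on [c m = b]: the total likelihood then has
    mean at most [r a b + M%:R]. The [M] messages contribute equally, and [q b * r a b = w a b]. *)
Lemma mean_channel_ge a b : 0 < q b ->
  w a b * (M%:R / (M%:R + r a b)) <= mean_channel a b.
Proof.
move=> qb; have qP := output_pmf_pmf.
have [P0 P1] := prod_pmf_pmf q M qP.
have [w0|wN] := eqVneq (w a b) 0.
  by rewrite w0 mul0r; case: (mean_channel_pmf a).
have wp : 0 < w a b by rewrite lt0r wN /=; case: (wP a).
have rp : 0 < r a b by rewrite divr_gt0.
pose t := r a b + M%:R.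
have tp : 0 < t by rewrite ltr_wpDr.
(* [1/S >= 2/t - S/t^2] for [S > 0]: the tangent line of [1/S] at [t]. *)
have term (c : {ffun 'I_M -> B}) (m : 'I_M) : (c m == b)%:R * (r a b * (2 / t - total_likelihood c a / t ^+ 2))
    <= likelihood_encoder c a m * (c m == b)%:R.
  case: eqVneq => [cm|]; last by rewrite mul0r mulr0.
  rewrite mul1r mulr1 /likelihood_encoder cm.
  set S := total_likelihood c a.
  have Sp : 0 < S.
    rewrite /S /total_likelihood (bigD1 m) //= cm ltr_pwDl //.
    by apply: sumr_ge0 => i _; apply: likelihood_ge0.
  rewrite gt_eqF //; apply: ler_wpM2l; first exact: ltW.
  rewrite -subr_ge0.
  have -> : S^-1 - (2 / t - S / t ^+ 2) = (S - t) ^+ 2 / (S * t ^+ 2).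
    by field; rewrite !gt_eqF.
  by rewrite divr_ge0 ?sqr_ge0 // mulr_ge0 ?exprn_ge0 // ltW.
have ind (m : 'I_M) : \sum_c prod_pmf q c * (c m == b)%:R = q b.
  rewrite (prod_pmf_expect1 q M m (fun t => (t == b)%:R)) //.
  rewrite (bigD1 b) //= eqxx mulr1 big1 ?addr0 // => s sb.
  by rewrite (negbTE sb) mulr0.
have each (m : 'I_M) : q b * r a b / t <=
    \sum_c prod_pmf q c * (likelihood_encoder c a m * (c m == b)%:R).
  apply: (@le_trans _ _ (\sum_c prod_pmf q c * ((c m == b)%:R *
     (r a b * (2 / t - total_likelihood c a / t ^+ 2))))); last first.
    by apply: ler_sum => c _; apply: ler_wpM2l.
  have -> : \sum_c prod_pmf q c * ((c m == b)%:R *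
     (r a b * (2 / t - total_likelihood c a / t ^+ 2))) =
     r a b * (2 / t) * q b - r a b / t ^+ 2 *
     \sum_c prod_pmf q c * ((c m == b)%:R * total_likelihood c a).
    rewrite -(ind m) !mulr_sumr -sumrB; apply: eq_bigr => c _; ring.
  have := tilted_total_likelihood_le a b m; rewrite -/t => le.
  have : r a b / t ^+ 2 * (\sum_c prod_pmf q c * ((c m == b)%:R * total_likelihood c a))
     <= r a b / t ^+ 2 * (q b * t).
    by apply: ler_wpM2l => //; rewrite divr_ge0 ?exprn_ge0 // ltW.
  have -> : r a b / t ^+ 2 * (q b * t) = q b * r a b / t by field; rewrite gt_eqF.
  have -> : r a b * (2 / t) * q b = 2 * (q b * r a b / t) by ring.
  lra.
have -> : w a b * (M%:R / (M%:R + r a b)) = \sum_(m < M) q b * r a b / t.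
  have -> : q b * r a b = w a b by rewrite /r mulrCA divff ?gt_eqF ?mulr1.
  by rewrite sumr_const card_ord -[in RHS]mulr_natr /t [r a b + _]addrC; ring.
rewrite /mean_channel /codebook_channel.
under [leRHS]eq_bigr do rewrite mulr_sumr.
by rewrite exchange_big /=; apply: ler_sum.
Qed.

(** The mean, under the joint law, of the relative shortfall [1 - M / (M + r)] left by
    [mean_channel_ge]. *)
Definition excess_rate : R :=
  \sum_a \sum_b p a * w a b * (r a b / (M%:R + r a b)).

(** The L1 distance of two probabilities is twice the sum of the positive parts of
    [w - mean_channel], so a lower bound on [mean_channel] is enough. *)
Lemma mean_channel_close :
  \sum_a \sum_b p a * `|mean_channel a b - w a b| <= 2 * excess_rate.
Proof.
rewrite /excess_rate mulr_sumr; apply: ler_sum => a _.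
rewrite -mulr_sumr.
under eq_bigr do rewrite distrC.
rewrite sum_positive_parts //; last exact: mean_channel_pmf.
rewrite mulrCA; apply: ler_wpM2l => //; rewrite mulr_sumr.
apply: ler_sum => b _; rewrite -mulrA.
have [->|pa] := eqVneq (p a) 0; first by rewrite !mul0r.
have [p0 _] := pP; apply: ler_wpM2l => //.
have w0 : 0 <= w a b by case: (wP a).
have r0 := likelihood_ge0 a b.
have Mr : 0 < M%:R + r a b by rewrite ltr_pwDl // ltr0n.
rewrite ge_max; apply/andP; split; last by apply: mulr_ge0 => //; apply: divr_ge0 => //; exact: ltW.
have [wz|wN] := eqVneq (w a b) 0.
  rewrite wz mul0r sub0r oppr_le0; by case: (mean_channel_pmf a).
have := mean_channel_ge a b (output_pmf_gt0 a b pa wN).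
have -> : M%:R / (M%:R + r a b) = 1 - r a b / (M%:R + r a b).
  by field; rewrite gt_eqF.
rewrite mulrBr mulr1; lra.
Qed.

Section CodebookFamily.
Variable M' : nat.
Hypothesis M'0 : (0 < M')%N.
Variables (d : A -> B -> R) (dm L : R).
Hypotheses (d_bound : forall a b, 0 <= d a b <= dm).
Hypotheses (L0 : 0 < L) (LM' : L ^+ 2 <= M'%:R).

Definition family_channel (C : {ffun 'I_M' -> {ffun 'I_M -> B}}) a b : R :=
  M'%:R^-1 * \sum_k codebook_channel (C k) a b.

Definition family_output C b : R := \sum_a p a * family_channel C a b.

Lemma dm_ge0 : 0 <= dm.
Proof.
have [a _] := pmf_pos _ pP; have [b _] := pmf_pos _ (wP a).
by case/andP: (d_bound a b); apply: le_trans.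
Qed.

Let mu : {ffun 'I_M' -> {ffun 'I_M -> B}} -> R := prod_pmf (prod_pmf q (n:=M)) (n:=M').

Lemma mean_family_channel a b :
  \sum_C mu C * family_channel C a b = mean_channel a b.
Proof.
have PP := prod_pmf_pmf q M output_pmf_pmf.
rewrite /family_channel.
under eq_bigr do rewrite mulrCA.
rewrite -mulr_sumr.
under eq_bigr do rewrite mulr_sumr.
rewrite exchange_big /=.
under eq_bigr => k _ do rewrite (prod_pmf_expect1 _ _ k (fun c => codebook_channel c a b)) //.
by rewrite sumr_const card_ord -[X in _ * X]mulr_natl mulrA mulVf ?mul1r // pnatr_eq0 -lt0n.
Qed.

Lemma mean_family_distortion :
  \sum_C mu C * (\sum_a \sum_b p a * family_channel C a b * d a b)
  <= \sum_a \sum_b p a * w a b * d a b + dm * (2 * excess_rate).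
Proof.
have -> : \sum_C mu C * (\sum_a \sum_b p a * family_channel C a b * d a b) =
  \sum_a \sum_b p a * mean_channel a b * d a b.
  under eq_bigr do rewrite mulr_sumr.
  rewrite exchange_big; apply: eq_bigr => a _ /=.
  under eq_bigr do rewrite mulr_sumr.
  rewrite exchange_big; apply: eq_bigr => b _ /=.
  rewrite -mean_family_channel mulr_sumr mulr_suml; apply: eq_bigr => C _; ring.
rewrite -lerBlDl -sumrB.
apply: le_trans (ler_wpM2l dm_ge0 mean_channel_close).
rewrite mulr_sumr; apply: ler_sum => a _.
rewrite -sumrB mulr_sumr; apply: ler_sum => b _.
have [p0 _] := pP; have /andP[d0 d1] := d_bound a b.
rewrite -mulrBl -mulrBr mulrCA -mulrA; apply: ler_wpM2l => //.
apply: (@le_trans _ _ (`|mean_channel a b - w a b| * d a b)).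
  by apply: ler_wpM2r => //; apply: ler_norm.
by rewrite mulrC; apply: ler_wpM2r.
Qed.

(** Bias plus fluctuation: the bias is controlled by [mean_channel_close], and averaging over [M']
    independent codebooks leaves a fluctuation of at most [L^-1] at each of the [#|B|] outputs. *)
Lemma mean_family_output_deviation :
  \sum_C mu C * (\sum_b `|family_output C b - q b|)
  <= 2 * excess_rate + #|B|%:R / L.
Proof.
have PP := prod_pmf_pmf q M output_pmf_pmf.
have [mu0 mu1] : is_pmf mu by apply: prod_pmf_pmf.
have [p0 p1] := pP.
pose h b (c : {ffun 'I_M -> B}) := \sum_a p a * codebook_channel c a b.
have h01 b c : 0 <= h b c <= 1.
  rewrite sumr_ge0 /= => [|a _]; last first.
    by apply: mulr_ge0 => //; case: (codebook_channel_pmf c a).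
  rewrite -p1; apply: ler_sum => a _; rewrite -[leRHS]mulr1.
  by apply: ler_wpM2l => //; apply: pmf_le1; apply: codebook_channel_pmf.
have famE C b : family_output C b = M'%:R^-1 * \sum_k h b (C k).
  rewrite /family_output /family_channel.
  under eq_bigr do rewrite mulrCA.
  rewrite -mulr_sumr; congr (_ * _); rewrite exchange_big /=.
  by apply: eq_bigr => a _; rewrite mulr_sumr.
have meanE b : \sum_c prod_pmf q c * h b c = \sum_a p a * mean_channel a b.
  rewrite /h /mean_channel.
  under eq_bigr do rewrite mulr_sumr.
  rewrite exchange_big; apply: eq_bigr => a _ /=; rewrite mulr_sumr.
  by apply: eq_bigr => c _; rewrite mulrCA.
under eq_bigr do rewrite mulr_sumr.
rewrite exchange_big /=.
apply: (@le_trans _ _ (\sum_b (\sum_a p a * `|mean_channel a b - w a b| + L^-1))).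
  apply: ler_sum => b _.
  apply: (@le_trans _ _ (\sum_C mu C *
      (`|\sum_c prod_pmf q c * h b c - q b| +
       `|M'%:R^-1 * (\sum_k h b (C k)) - \sum_c prod_pmf q c * h b c|))).
    apply: ler_sum => C _; apply: ler_wpM2l => //.
    rewrite famE; apply: le_trans (ler_normD _ _).
    by rewrite [X in _ <= `|X|]addrC addrA subrK.
  under eq_bigr do rewrite mulrDr.
  rewrite big_split /= -mulr_suml mu1 mul1r; apply: lerD; last first.
    exact: abs_mean_deviation.
  rewrite meanE /q -sumrB; apply: le_trans (ler_norm_sum _ _ _) _.
  by apply: ler_sum => a _; rewrite -mulrBr normrM (ger0_norm (p0 a)).
rewrite big_split /= exchange_big /= sumr_const -[L^-1 *+ _]mulr_natl lerD2r.
exact: mean_channel_close.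
Qed.

(** Distortion and output deviation are added into one functional, so that a single family is good
    for both. The weight [dm] is the largest price of correcting a wrong output. *)
Lemma good_family_exists : exists C,
  \sum_a \sum_b p a * family_channel C a b * d a b
    + dm * (\sum_b `|family_output C b - q b|)
  <= \sum_a \sum_b p a * w a b * d a b
     + dm * (4 * excess_rate + #|B|%:R / L).
Proof.
have PP := prod_pmf_pmf q M output_pmf_pmf.
apply: (pmf_average_witness mu); first exact: prod_pmf_pmf.
under eq_bigr do rewrite mulrDr [X in _ + X]mulrCA.
rewrite big_split /= -mulr_sumr.
have := mean_family_distortion.
have := ler_wpM2l dm_ge0 mean_family_output_deviation.
set x := \sum_C _; set y := \sum_C _; set z := \sum_a _; lra.
Qed.

End CodebookFamily.
End Codebook.

(** The decoder passes the selected codeword through the coupling channel from [family_output] to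
    [q]. The output law becomes exactly [q], and the price is [dm] times the probability of a move,
    already counted in [good_family_exists]. *)
Lemma one_shot_code (M M' : nat) (d : A -> B -> R) (dm L : R) :
  (0 < M)%N -> (forall a b, 0 <= d a b <= dm) -> 0 < L -> L ^+ 2 <= M'%:R ->
  exists (e : A -> 'I_M' -> 'I_M -> R) (g : 'I_M -> 'I_M' -> B -> R),
  [/\ forall a k, is_pmf (e a k), forall m k, is_pmf (g m k),
   forall b, \sum_a \sum_k p a * M'%:R^-1 * (\sum_m e a k m * g m k b) = q b &
   \sum_a \sum_k \sum_b p a * M'%:R^-1 * (\sum_m e a k m * g m k b) * d a b
   <= \sum_a \sum_b p a * w a b * d a b
     + dm * (4 * excess_rate M + #|B|%:R / L)].
Proof.
move=> M0 db L0 LM'.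
have M'0 : (0 < M')%N.
  by rewrite -(@ltr0n R); apply: lt_le_trans LM'; rewrite exprn_gt0.
have M'V : M'%:R^-1 * M'%:R = 1 :> R by rewrite mulVf // pnatr_eq0 -lt0n.
have [C HC] := good_family_exists M M0 M' M'0 d dm L db L0 LM'.
have [p0 p1] := pP.
have famP a : is_pmf (family_channel M M' C a).
  split=> [b|]; first by rewrite mulr_ge0 ?invr_ge0 ?ler0n //; apply: sumr_ge0 => k _;
    case: (codebook_channel_pmf M M0 (C k) a).
  rewrite /family_channel -mulr_sumr exchange_big /=.
  under eq_bigr => k _ do rewrite (proj2 (codebook_channel_pmf M M0 (C k) a)).
  by rewrite sumr_const card_ord.
have outP : is_pmf (family_output M M' C).
  split=> [b|]; first by apply: sumr_ge0 => a _; apply: mulr_ge0 => //; case: (famP a).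
  rewrite exchange_big -p1; apply: eq_bigr => a _ /=.
  by rewrite -mulr_sumr (proj2 (famP a)) mulr1.
have [K [KP Kq Kd]] := coupling_channel _ _ outP output_pmf_pmf.
exists (fun a k => likelihood_encoder M (C k) a).
exists (fun m k => K (C k m)).
have jointE a b : \sum_k p a * M'%:R^-1 *
    (\sum_m likelihood_encoder M (C k) a m * K (C k m) b)
    = p a * \sum_b' family_channel M M' C a b' * K b' b.
  rewrite -mulr_sumr -mulrA; congr (_ * _).
  rewrite /family_channel.
  under [RHS]eq_bigr do rewrite -mulrA mulr_suml.
  rewrite -mulr_sumr; congr (_ * _); rewrite [RHS]exchange_big; apply: eq_bigr => k _ /=.
  rewrite /codebook_channel.
  under [RHS]eq_bigr do rewrite mulr_suml.
  rewrite exchange_big; apply: eq_bigr => m _ /=.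
  rewrite (bigD1 (C k m)) //= eqxx mulr1 big1 ?addr0 // => b' bm.
  by rewrite eq_sym (negbTE bm) mulr0 mul0r.
split=> [a k|m k|b|].
- exact: likelihood_encoder_pmf.
- exact: KP.
- under eq_bigr do rewrite jointE.
  rewrite -Kq /family_output.
  under eq_bigr do rewrite mulr_sumr.
  rewrite exchange_big; apply: eq_bigr => b' _ /=.
  by rewrite mulr_suml; apply: eq_bigr => a _; rewrite mulrA.
- apply: le_trans HC.
  have dm0 := dm_ge0 d dm db.
  (* A codeword that [K] leaves in place keeps its distortion; a moved one costs at most [dm], with
     probability [1 - K b' b']. *)
  apply: (@le_trans _ _ (\sum_a \sum_b' p a * family_channel M M' C a b' *
     (d a b' + dm * (1 - K b' b')))).
    apply: ler_sum => a _; rewrite exchange_big /=.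
    under eq_bigr do rewrite -mulr_suml jointE mulr_sumr mulr_suml.
    rewrite exchange_big; apply: ler_sum => b' _ /=.
    rewrite (eq_bigr (fun b => p a * family_channel M M' C a b' * (K b' b * d a b))); last first.
      by move=> b _; ring.
    rewrite -mulr_sumr; apply: ler_wpM2l.
      by apply: mulr_ge0 => //; case: (famP a).
    have [K0 K1] := KP b'.
    rewrite (bigD1 b') //=; apply: lerD.
      rewrite -[leRHS]mul1r; apply: ler_wpM2r; first by case/andP: (db a b').
      exact: pmf_le1.
    rewrite -K1 [in leRHS](bigD1 b') //= addrAC subrr add0r mulr_sumr.
    apply: ler_sum => b _; rewrite mulrC; apply: ler_wpM2r => //.
    by case/andP: (db a b).
  under eq_bigr do under eq_bigr do rewrite mulrDr.
  under eq_bigr do rewrite big_split /=.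
  rewrite big_split /= lerD2l.
  apply: le_trans (ler_wpM2l dm0 Kd).
  rewrite mulr_sumr exchange_big /=; apply: ler_sum => b _.
  rewrite /family_output mulr_suml mulr_sumr; apply: ler_sum => a _.
  by rewrite le_eqVlt; apply/orP; left; apply/eqP; ring.
Qed.

End OneShot.

(** * Exponential estimates *)

Section RealFacts.
Context {R : realType}.

Lemma expR_ln_prod {I : finType} (F : I -> R) : (forall i, 0 < F i) ->
  expR (\sum_i ln (F i)) = \prod_i F i.
Proof. by move=> F0; rewrite expR_sum; apply: eq_bigr => i _; rewrite lnK ?posrE. Qed.

Lemma ln_prod {I : finType} (F : I -> R) : (forall i, 0 < F i) ->
  ln (\prod_i F i) = \sum_i ln (F i).
Proof. by move=> F0; rewrite -expR_ln_prod // expRK. Qed.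

Lemma ln_le_sub1 (u : R) : 0 < u -> ln u <= u - 1.
Proof.
by move=> u0; have := @le_ln1Dx R (u - 1); rewrite addrCA subrr addr0; apply; lra.
Qed.

(** The left side is at most both 1 and [u / M], hence at most the power [s] of [u / M]. This turns
    the excess rate into an exponential moment. *)
Lemma ratio_le_expR (s u M : R) : 0 < u -> 0 < M -> 0 < s <= 1 ->
  u / (M + u) <= expR (s * (ln u - ln M)).
Proof.
move=> u0 M0 /andP[s0 s1]; have Mu : 0 < M + u by apply: addr_gt0.
have [uM|Mu'] := lerP u M; last first.
  apply: (@le_trans _ _ 1); first by rewrite ler_pdivrMr // mul1r lerDr ltW.
  apply: le_trans (expR_ge1Dx _); rewrite lerDl mulr_ge0 ?(ltW s0) // subr_ge0.
  by rewrite ler_ln ?posrE // ltW.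
apply: (@le_trans _ _ (u / M)).
  by rewrite ler_pM2l // lef_pV2 ?posrE // lerDl ltW.
have -> : u / M = expR (ln u - ln M) by rewrite expRB !lnK ?posrE.
rewrite ler_expR.
have : ln u - ln M <= 0 by rewrite subr_le0 ler_ln ?posrE.
nra.
Qed.

(** From [expR (- u) >= 1 - u] comes [expR u <= (1 - u)^-1], and [(1 - u) * (1 + u + 2 * u ^+ 2) = 1
    + u ^+ 2 * (1 - 2 * u) >= 1]. *)
Lemma expR_le_quadratic (u : R) : `|u| <= 2^-1 -> expR u <= 1 + u + 2 * u ^+ 2.
Proof.
rewrite ler_norml => /andP[ul uu].
have h : 0 < 1 - u by lra.
have : (1 - u) * expR u <= 1.
  rewrite -[leRHS](mulVf (lt0r_neq0 (expR_gt0 u))) ler_wpM2r ?expR_ge0 //.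
  by rewrite -expRN; have := expR_ge1Dx (- u).
rewrite -ler_pdivlMl // => /le_trans; apply.
rewrite ler_pdivrMl // expr2; nra.
Qed.

Lemma mgf_bound {T : finType} (p f : T -> R) (eta : R) : is_pmf p -> 0 < eta ->
  exists s : R, 0 < s <= 1 /\
  \sum_t p t * expR (s * f t) <= expR (s * (\sum_t p t * f t + eta)).
Proof.
move=> [p0 p1] eta0; pose B := \sum_t `|f t|.
have B0 : 0 <= B by apply: sumr_ge0.
have fB t : `|f t| <= B by rewrite /B (bigD1 t) //= lerDl sumr_ge0.
have B1 : 0 < B + 1 by lra.
(* The first bound gives [|s * f t| <= 2^-1], the range of [expR_le_quadratic]; the second makes the
   quadratic term at most [s * eta]. *)
pose s := Num.min (2^-1 / (B + 1)) (2^-1 * eta / (B + 1) ^+ 2).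
have s0 : 0 < s.
  by rewrite lt_min; apply/andP; split; apply: divr_gt0 => //; [exact: mulr_gt0|exact: exprn_gt0].
have sB : s * (B + 1) <= 2^-1 by rewrite -ler_pdivlMr // /s ge_min lexx.
have sE : s * (B + 1) ^+ 2 <= 2^-1 * eta.
  by rewrite -ler_pdivlMr ?exprn_gt0 // /s ge_min lexx orbT.
exists s; split; first by rewrite s0 /=; nra.
apply: le_trans (expR_ge1Dx _).
apply: (@le_trans _ _ (\sum_t p t * (1 + s * f t + s * eta))).
  apply: ler_sum => t _; apply: ler_wpM2l => //.
  have := fB t; rewrite ler_norml => /andP[f1 f2].
  apply: (@le_trans _ _ (1 + s * f t + 2 * (s * f t) ^+ 2)).
    apply: expR_le_quadratic; rewrite ler_norml; nra.
  rewrite lerD2l expr2.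
  have f2B : (f t) ^+ 2 <= (B + 1) ^+ 2 by rewrite !expr2; nra.
  have : s * (s * (f t) ^+ 2) <= s * (s * (B + 1) ^+ 2).
    by rewrite ler_pM2l // ler_pM2l.
  have : s * (s * (B + 1) ^+ 2) <= s * (2^-1 * eta) by rewrite ler_pM2l.
  rewrite !expr2 in sE f2B *; lra.
under eq_bigr do rewrite mulrDr mulrDr mulr1 mulrCA.
by rewrite !big_split /= p1 -mulr_suml p1 mul1r -mulr_sumr -addrA -mulrDr.
Qed.

Lemma expR_decay (K c e : R) : 0 < c -> 0 < e ->
  exists N : nat, forall n : nat, (N <= n)%N -> K * expR (- (n%:R * c)) <= e.
Proof.
move=> c0 e0; exists (Num.trunc (`|K| / (e * c))).+1 => n nN.
have ec : 0 < e * c by apply: mulr_gt0.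
have Kn : `|K| / (e * c) <= n%:R.
  by apply: le_trans (ltW (truncnS_gt _)) _; rewrite ler_nat.
have nc : 0 <= n%:R * c :> R by rewrite mulr_ge0 ?ler0n // ltW.
rewrite expRN ler_pdivrMr ?expR_gt0 //.
apply: le_trans (ler_norm _) _.
rewrite ler_pdivrMr // in Kn; apply: le_trans Kn _.
rewrite mulrCA; apply: ler_wpM2l; first exact: ltW.
by have := expR_ge1Dx (n%:R * c); lra.
Qed.

(** Rows of positive mass are normalised; a row of mass 0 vanishes identically, and the point mass
    at [b0] serves there. *)
Lemma disintegration {A B : finType} (J : A -> B -> R) (b0 : B) :
  (forall a b, 0 <= J a b) ->
  exists K : A -> B -> R, (forall a, is_pmf (K a)) /\
    forall a b, J a b = (\sum_b' J a b') * K a b.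
Proof.
move=> J0; exists (fun a b => if \sum_b' J a b' == 0 then (b == b0)%:R
  else J a b / \sum_b' J a b'); split=> [a|a b]; last first.
  case: eqVneq => [S|S]; last by rewrite mulrCA divff ?mulr1.
  rewrite S mul0r; apply/eqP; rewrite eq_le J0 andbT -S (bigD1 b) //= lerDl.
  exact: sumr_ge0.
case: eqVneq => S; split=> [b|].
- by rewrite ler0n.
- by rewrite (bigD1 b0) //= eqxx big1 ?addr0 // => b bb; rewrite (negbTE bb).
- by rewrite divr_ge0 // sumr_ge0.
- by rewrite -mulr_suml divff.
Qed.

(** Rounding down a real number that is at least 1 loses at most half of it. *)
Lemma card_rate_ge_half (n : nat) (r : R) : 0 <= r ->
  expR (n%:R * (r * ln 2)) / 2 <= (card_rate n r)%:R.
Proof.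
move=> r0; rewrite /card_rate /powR pnatr_eq0 /= -mulrA.
set x := expR _.
have x1 : 1 <= x by rewrite -expR0 ler_expR mulr_ge0 ?mulr_ge0 ?ln_ge0 ?ler1n.
have := truncnS_gt x.
have : (1 : R) <= (Num.trunc x)%:R by rewrite ler1n truncn_gt0.
rewrite -natr1; lra.
Qed.

End RealFacts.

(** * Block codes *)

Section Achievability.
Context {R : realType} {X Z : finType}.
Variables (PXZ : X * Z -> R) (W : X -> Z -> X -> R).
Variables (D : X -> X -> R) (dmax : R).
Hypotheses (PP : is_pmf PXZ) (WP : forall x z, is_pmf (W x z)).
Hypothesis D_bound : forall x y, 0 <= D x y <= dmax.

Definition margZ (z : Z) : R := \sum_x PXZ (x, z).

Lemma sum_PXZ : \sum_x \sum_z PXZ (x, z) = 1.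
Proof. by case: PP => _ <-; rewrite pair_big /=; apply: eq_bigr => -[]. Qed.

Lemma margZ_ge0 z : 0 <= margZ z.
Proof. by apply: sumr_ge0 => x _; case: PP. Qed.

Lemma margX_pmf : is_pmf (margX PXZ).
Proof.
split=> [x|]; last exact: sum_PXZ.
by apply: sumr_ge0 => z _; case: PP.
Qed.

Lemma margY_pmf : is_pmf (margY PXZ W).
Proof.
split=> [y|].
  apply: sumr_ge0 => x _; apply: sumr_ge0 => z _; apply: mulr_ge0.
    by case: PP.
  by case: (WP x z).
rewrite exchange_big -[RHS]sum_PXZ; apply: eq_bigr => x _ /=.
rewrite exchange_big; apply: eq_bigr => z _ /=.
by rewrite /single_joint -mulr_sumr (proj2 (WP x z)) mulr1.
Qed.

Variable V : Z -> X -> R.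
Hypothesis VP : forall z, is_pmf (V z).
Hypothesis PXZ_V : forall x z, PXZ (x, z) = margZ z * V z x.

Definition reverse_output (z : Z) : X -> R := output_pmf (V z) (fun x => W x z).
Local Notation Q := reverse_output.

(** The conditional information density in nats; the factor [ln 2] in later statements converts from
    bits. *)
Definition info_density x y z : R := ln (W x z y / Q z y).

Lemma single_joint_ge0 x y z : 0 <= single_joint PXZ W x y z.
Proof. by apply: mulr_ge0; [case: PP|case: (WP x z)]. Qed.

Lemma sum_joint_y x z : \sum_y single_joint PXZ W x y z = PXZ (x, z).
Proof. by rewrite /single_joint -mulr_sumr (proj2 (WP x z)) mulr1. Qed.

Lemma sum_joint_x y z : \sum_x single_joint PXZ W x y z = margZ z * Q z y.
Proof.
by rewrite mulr_sumr; apply: eq_bigr => x _; rewrite /single_joint PXZ_V mulrA.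
Qed.

Lemma joint_neq0 x y z : single_joint PXZ W x y z != 0 ->
  [/\ 0 < margZ z, 0 < V z x, 0 < W x z y & 0 < Q z y].
Proof.
rewrite /single_joint PXZ_V !mulf_eq0 !negb_or => /andP[/andP[z0 v0] w0].
split; rewrite ?lt0r ?z0 ?v0 ?w0 /=.
- exact: margZ_ge0.
- by case: (VP z).
- by case: (WP x z).
- by rewrite -lt0r; apply: (output_pmf_gt0 _ _ (VP z) (fun x => WP x z) x y v0 w0).
Qed.

Lemma cond_mutinf_info_density :
  cond_mutinf PXZ W * ln 2 =
  \sum_x \sum_y \sum_z single_joint PXZ W x y z * info_density x y z.
Proof.
rewrite /cond_mutinf mulr_suml; apply: eq_bigr => x _.
rewrite mulr_suml; apply: eq_bigr => y _.
rewrite mulr_suml; apply: eq_bigr => z _.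
case: eqVneq => [->|J0]; first by rewrite !mul0r.
have [z0 v0 w0 q0] := joint_neq0 x y z J0.
rewrite sum_joint_x sum_joint_y.
under eq_bigr do rewrite sum_joint_y.
rewrite -/(margZ z) -mulrA; congr (_ * _).
rewrite /log2 divfK; last by rewrite gt_eqF // ln_gt0 // ltr1n.
congr ln; rewrite /single_joint PXZ_V; field; rewrite !gt_eqF //.
Qed.

(** Gibbs' inequality. It makes the coding rate nonnegative, as [card_rate_ge_half] requires. *)
Lemma cond_mutinf_ge0 : 0 <= cond_mutinf PXZ W.
Proof.
have ln2 : 0 < ln 2 :> R by rewrite ln_gt0 // ltr1n.
rewrite -(pmulr_lge0 _ ln2) cond_mutinf_info_density.
have VQ z : is_pmf (Q z) by apply: output_pmf_pmf.
apply: (@le_trans _ _ (\sum_x \sum_y \sum_z (single_joint PXZ W x y z -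
   margZ z * V z x * Q z y))).
  have -> : \sum_x \sum_y \sum_z (single_joint PXZ W x y z -
     margZ z * V z x * Q z y) = 0; last exact: lexx.
  rewrite big1 // => x _; rewrite exchange_big big1 //= => z _.
  by rewrite sumrB sum_joint_y -mulr_sumr (proj2 (VQ z)) mulr1 PXZ_V subrr.
apply: ler_sum => x _; apply: ler_sum => y _; apply: ler_sum => z _.
have [J0|J0] := eqVneq (single_joint PXZ W x y z) 0.
  rewrite J0 mul0r sub0r oppr_le0 mulr_ge0 ?mulr_ge0 ?margZ_ge0 //.
    by case: (VP z).
  by case: (VQ z).
have [z0 v0 w0 q0] := joint_neq0 x y z J0.
have -> : single_joint PXZ W x y z - margZ z * V z x * Q z y =
   single_joint PXZ W x y z * (1 - Q z y / W x z y).
  by rewrite /single_joint PXZ_V; field; rewrite gt_eqF.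
apply: ler_wpM2l; first exact: single_joint_ge0.
have -> : info_density x y z = - ln (Q z y / W x z y).
  by rewrite -lnV ?posrE ?divr_gt0 // invf_div.
have := ln_le_sub1 (Q z y / W x z y) (divr_gt0 q0 w0); lra.
Qed.

(** The one-shot code is used with blocks as letters, separately for each [z]. The excess rate is
    bounded by an exponential moment that factors over coordinates. The factor [n%:R^-1 * n%:R] is 1
    except at [n = 0], where it is 0. *)
Lemma iid_code (n M M' : nat) (s L : R) :
  (0 < M)%N -> 0 < s <= 1 -> 0 < L -> L ^+ 2 <= M'%:R ->
  exists (f : encoder R X Z n M M') (g : decoder R X Z n M M'),
  [/\ valid_code f g, code_iid PXZ f g,
      out_dist PXZ f g = prod_pmf (margY PXZ W) (n:=n) &
      exp_dist PXZ D f g <= (n%:R^-1 * n%:R) * single_exp_dist PXZ W D +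
       dmax * (4 * (expR (- (s * ln M%:R)) * (\sum_x \sum_y \sum_z
         single_joint PXZ W x y z * expR (s * info_density x y z)) ^+ n)
         + (#|X| ^ n)%:R / L)].
Proof.
move=> M0 s01 L0 LM'.
have MR0 : (0 : R) < M%:R by rewrite ltr0n.
pose XN := {ffun 'I_n -> X}; pose ZN := {ffun 'I_n -> Z}.
pose p (z : ZN) (x : XN) : R := \prod_i V (z i) (x i).
pose w (z : ZN) (x y : XN) : R := \prod_i W (x i) (z i) (y i).
pose pz (z : ZN) : R := \prod_i margZ (z i).
pose d (x y : XN) : R := n%:R^-1 * \sum_i D (x i) (y i).
have pP z : is_pmf (p z) by apply: (pmf_ffun (fun i => V (z i))).
have wP z x : is_pmf (w z x) by apply: (pmf_ffun (fun i => W (x i) (z i))).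
have pz0 z : 0 <= pz z by apply: prodr_ge0 => i _; apply: margZ_ge0.
have dmax0 : 0 <= dmax.
  have [x _] := pmf_pos _ margX_pmf.
  by case/andP: (D_bound x x); apply: le_trans.
have d01 x y : 0 <= d x y <= dmax.
  rewrite mulr_ge0 ?invr_ge0 ?ler0n //=; last first.
    by apply: sumr_ge0 => i _; case/andP: (D_bound (x i) (y i)).
  apply: (@le_trans _ _ (n%:R^-1 * (n%:R * dmax))).
    apply: ler_wpM2l; first by rewrite invr_ge0 ler0n.
    apply: (@le_trans _ _ (\sum_(i < n) dmax)).
      by apply: ler_sum => i _; case/andP: (D_bound (x i) (y i)).
    by rewrite sumr_const card_ord mulr_natl.
  rewrite mulrA; have [->|n0] := eqVneq n 0%N; first by rewrite invr0 !mul0r.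
  by rewrite mulVf ?mul1r // pnatr_eq0.
have qE z y : output_pmf (p z) (w z) y = \prod_i Q (z i) (y i).
  rewrite /Q /reverse_output /output_pmf bigA_distr_bigA; apply: eq_bigr => x _.
  by rewrite -big_split.
have PE (x : XN) (z : ZN) : \prod_(i < n) PXZ (x i, z i) = pz z * p z x.
  by rewrite -big_split; apply: eq_bigr => i _; apply: PXZ_V.
pose good (z : ZN) (eg : (XN -> 'I_M' -> 'I_M -> R) * ('I_M -> 'I_M' -> XN -> R)) :=
  [/\ forall a k, is_pmf (eg.1 a k), forall m k, is_pmf (eg.2 m k),
   forall b, \sum_a \sum_k p z a * M'%:R^-1 * (\sum_m eg.1 a k m * eg.2 m k b)
     = output_pmf (p z) (w z) b &
   \sum_a \sum_k \sum_b p z a * M'%:R^-1 * (\sum_m eg.1 a k m * eg.2 m k b) * d a b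
   <= \sum_a \sum_b p z a * w z a b * d a b
     + dmax * (4 * excess_rate (p z) (w z) M + #|{: XN}|%:R / L)].
have good_ex z : exists eg, good z eg.
  by have [e [g H]] := one_shot_code (p z) (w z) (pP z) (wP z) M M' d dmax L M0 d01 L0 LM';
    exists (e, g).
(* Encoder and decoder both see [z], so they can agree on a code chosen for that block. *)
have [fg fgP] := choice good_ex.
pose f : encoder R X Z n M M' := fun x z k => (fg z).1 x k.
pose g : decoder R X Z n M M' := fun m z k => (fg z).2 m k.
have jE x z k y : code_joint PXZ f g x z k y =
    pz z * (p z x * M'%:R^-1 * \sum_m (fg z).1 x k m * (fg z).2 m k y).
  by rewrite /code_joint PE -!mulrA.
have YZE y z : YZ_dist PXZ f g y z = \prod_i (margZ (z i) * Q (z i) (y i)).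
  rewrite /YZ_dist big_split /= -qE; have [_ _ <- _] := fgP z.
  rewrite mulr_sumr; apply: eq_bigr => x _; rewrite mulr_sumr.
  by apply: eq_bigr => k _; rewrite jE.
have QP z : is_pmf (Q z) by apply: output_pmf_pmf.
exists f, g; split.
- by split=> [x z k|m z k]; have [fP gP _ _] := fgP z; [apply: fP|apply: gP].
- exists (fun yz => margZ yz.2 * Q yz.2 yz.1); split; last exact: YZE.
  split=> [[y z]|] /=; first by rewrite mulr_ge0 ?margZ_ge0 //; case: (QP z).
  rewrite -(pair_big xpredT xpredT (fun y z => margZ z * Q z y)) /= exchange_big /=.
  rewrite -[RHS]sum_PXZ [RHS]exchange_big; apply: eq_bigr => z _ /=.
  by rewrite -mulr_sumr (proj2 (QP z)) mulr1.
- apply/funext => y; rewrite /out_dist exchange_big /=.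
  transitivity (\sum_z YZ_dist PXZ f g y z) => //.
  under eq_bigr do rewrite YZE.
  rewrite -(bigA_distr_bigA (fun i c => margZ c * Q c (y i))).
  apply: eq_bigr => i _; rewrite /margY exchange_big; apply: eq_bigr => z _ /=.
  by rewrite sum_joint_x.
have PW1 : \sum_x \sum_y \sum_z single_joint PXZ W x y z = 1.
  rewrite -[RHS]sum_PXZ; apply: eq_bigr => x _.
  by rewrite exchange_big; apply: eq_bigr => z _ /=; rewrite sum_joint_y.
have jointE (x y : XN) (z : ZN) :
    \prod_i single_joint PXZ W (x i) (y i) (z i) = pz z * (p z x * w z x y).
  rewrite -!big_split; apply: eq_bigr => i _.
  by rewrite /single_joint PXZ_V /= mulrA.
(* On the support of the joint law the block likelihood is a product of positive single-letter
   ratios, so [ratio_le_expR] gives a product of exponentials of information densities. *)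
have exc (z : ZN) : pz z * excess_rate (p z) (w z) M <=
   expR (- (s * ln M%:R)) * \sum_(x : XN) \sum_(y : XN) \prod_i (single_joint PXZ W (x i) (y i) (z i)
      * expR (s * info_density (x i) (y i) (z i))).
  rewrite /excess_rate !mulr_sumr; apply: ler_sum => x _.
  rewrite !mulr_sumr; apply: ler_sum => y _.
  rewrite mulrA -jointE [in leRHS]big_split /= [leRHS]mulrCA.
  set J := \prod_i single_joint PXZ W (x i) (y i) (z i).
  have [J0|/prodf_neq0 J0] := eqVneq J 0; first by rewrite J0 !mul0r.
  have pos i := joint_neq0 _ _ _ (J0 i isT).
  apply: ler_wpM2l; first by apply: prodr_ge0 => i _; apply: single_joint_ge0.
  have ratio i : 0 < W (x i) (z i) (y i) / Q (z i) (y i).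
    by have [_ _ w0 q0] := pos i; apply: divr_gt0.
  have -> : likelihood (p z) (w z) x y = \prod_i (W (x i) (z i) (y i) / Q (z i) (y i)).
    by rewrite /likelihood qE -prodf_div.
  set u := \prod_i (W (x i) (z i) (y i) / Q (z i) (y i)).
  have u0 : 0 < u by apply: prodr_gt0 => i _.
  apply: le_trans (ratio_le_expR s _ _ u0 MR0 s01) _.
  by rewrite -expR_sum -expRD -mulr_sumr -ln_prod // -/u mulrBr addrC.
have avg_exc : \sum_z pz z * excess_rate (p z) (w z) M <=
   expR (- (s * ln M%:R)) * (\sum_x \sum_y \sum_z
         single_joint PXZ W x y z * expR (s * info_density x y z)) ^+ n.
  apply: (@le_trans _ _ (\sum_(z : ZN) expR (- (s * ln M%:R)) * \sum_(x : XN)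
    \sum_(y : XN) \prod_i (single_joint PXZ W (x i) (y i) (z i)
      * expR (s * info_density (x i) (y i) (z i))))).
    by apply: ler_sum => z _; apply: exc.
  rewrite -mulr_sumr; apply: ler_wpM2l; first exact: expR_ge0.
  rewrite (sum3_prod (fun (i : 'I_n) c a b => single_joint PXZ W a b c
     * expR (s * info_density a b c))) prodr_const card_ord.
  rewrite exchange_big /=.
  by under eq_bigr do rewrite exchange_big /=.
have distE : \sum_z pz z * (\sum_x \sum_y p z x * w z x y * d x y)
   = n%:R^-1 * n%:R * single_exp_dist PXZ W D.
  have coord (i : 'I_n) : \sum_(z : ZN) \sum_(x : XN) \sum_(y : XN)
      (\prod_j single_joint PXZ W (x j) (y j) (z j)) * D (x i) (y i)
      = single_exp_dist PXZ W D.
    transitivity (\sum_(z : ZN) \sum_(x : XN) \sum_(y : XN) \prod_j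
      (single_joint PXZ W (x j) (y j) (z j) * (if j == i then D (x j) (y j) else 1))).
      apply: eq_bigr => z _; apply: eq_bigr => x _; apply: eq_bigr => y _.
      by rewrite [RHS]big_split /= prod_at.
    rewrite (sum3_prod (fun j c a b => single_joint PXZ W a b c *
      (if j == i then D a b else 1))).
    rewrite -[RHS](prod_at i (fun=> _)); apply: eq_bigr => j _.
    rewrite exchange_big /=.
    under eq_bigr do rewrite exchange_big /=.
    case: eqP => // _; rewrite -[RHS]PW1.
    by do 3!apply: eq_bigr => ? _; rewrite mulr1.
  have sum_n : \sum_(i < n) single_exp_dist PXZ W D = n%:R * single_exp_dist PXZ W D.
    by rewrite sumr_const card_ord mulr_natl.
  rewrite -mulrA -sum_n [RHS]mulr_sumr.
  under [RHS]eq_bigr => i _ do rewrite -(coord i) mulr_sumr.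
  rewrite [RHS]exchange_big; apply: eq_bigr => z _ /=.
  under [RHS]eq_bigr do rewrite mulr_sumr.
  rewrite mulr_sumr [RHS]exchange_big; apply: eq_bigr => x _ /=.
  under [RHS]eq_bigr do rewrite mulr_sumr.
  rewrite mulr_sumr [RHS]exchange_big; apply: eq_bigr => y _ /=.
  by rewrite -mulr_sumr -mulr_sumr jointE /d; ring.
have pz1 : \sum_z pz z = 1.
  rewrite -(bigA_distr_bigA (fun i => margZ)) big1 // => i _.
  by rewrite -[RHS]sum_PXZ exchange_big.
have XN_card : #|{: XN}| = (#|X| ^ n)%N by rewrite card_ffun card_ord.
have -> : exp_dist PXZ D f g = \sum_z pz z * (\sum_x \sum_k \sum_y
   p z x * M'%:R^-1 * (\sum_m (fg z).1 x k m * (fg z).2 m k y) * d x y).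
  rewrite /exp_dist exchange_big; apply: eq_bigr => z _ /=.
  rewrite mulr_sumr; apply: eq_bigr => x _.
  rewrite mulr_sumr; apply: eq_bigr => k _.
  rewrite mulr_sumr; apply: eq_bigr => y _.
  by rewrite jE -mulrA.
apply: (@le_trans _ _ (\sum_z pz z * (\sum_x \sum_y p z x * w z x y * d x y
     + dmax * (4 * excess_rate (p z) (w z) M + (#|X| ^ n)%:R / L)))).
  apply: ler_sum => z _; apply: ler_wpM2l => //; rewrite -XN_card.
  by have [_ _ _] := fgP z.
under eq_bigr do rewrite mulrDr.
rewrite big_split /= distE lerD2l.
under eq_bigr do rewrite mulrCA mulrDr [pz _ * (4 * _)]mulrCA.
rewrite -mulr_sumr; apply: ler_wpM2l => //.
rewrite big_split /= -mulr_sumr -mulr_suml pz1 mul1r lerD2r.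
by apply: ler_wpM2l.
Qed.

End Achievability.

(** * Total variation of product laws *)

Section TotalVariation.
Context {R : realType} {T : finType}.

Lemma dTV_leP (p q : T -> R) (c : R) : dTV p q <= c <->
  0 <= c /\ forall A : {set T}, `| \sum_(t in A) p t - \sum_(t in A) q t | <= c.
Proof.
rewrite /dTV; split=> [h|[c0 h]]; last by apply: bigmax_le => // A _; apply: h.
split=> [|A].
  by apply: le_trans h; apply: bigmax_ge_id.
by apply: le_trans h; exact: (le_bigmax 0 (fun A : {set T} => `| \sum_(t in A) p t - \sum_(t in A) q t |)).
Qed.

Lemma dTV_ge (p q : T -> R) (A : {set T}) :
  `| \sum_(t in A) p t - \sum_(t in A) q t | <= dTV p q.
Proof. by have [_] := proj1 (dTV_leP p q (dTV p q)) (lexx _); apply. Qed.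

Lemma dTV_ge0 (p q : T -> R) : 0 <= dTV p q.
Proof. by have [] := proj1 (dTV_leP p q (dTV p q)) (lexx _). Qed.

Lemma dTV_le1 (p q : T -> R) : is_pmf p -> is_pmf q -> dTV p q <= 1.
Proof.
have H (r : T -> R) (A : {set T}) : is_pmf r -> 0 <= \sum_(t in A) r t <= 1.
  move=> [r0 <-]; rewrite sumr_ge0 //= [leRHS](bigID (mem A)) /= lerDl.
  exact: sumr_ge0.
move=> pP qP; apply/dTV_leP; split=> // A.
move: (H p A pP) (H q A qP) => /andP[? ?] /andP[? ?].
by rewrite ler_norml; apply/andP; split; lra.
Qed.

End TotalVariation.

Section ProductVariation.
Context {R : realType} {T : finType}.

Definition ffun_prefix m l (y : {ffun 'I_(m + l) -> T}) : {ffun 'I_m -> T} :=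
  [ffun i => y (lshift l i)].

Lemma prod_pmf_prefix (p : T -> R) m l (x : {ffun 'I_m -> T}) : is_pmf p ->
  \sum_(y | ffun_prefix m l y == x) prod_pmf p (n:=m + l) y = prod_pmf p x.
Proof.
move=> [_ p1].
(* The event that the prefix equals [x] has indicator [\prod_i g i (y i)], with factor 1 at the
   coordinates past [m]. *)
pose g (i : 'I_(m + l)) (t : T) : R :=
  match fintype.split i with inl j => (t == x j)%:R | inr _ => 1 end.
transitivity (\sum_y prod_pmf p (n:=m + l) y * \prod_i g i (y i)).
  rewrite big_mkcond; apply: eq_bigr => y _ /=.
  rewrite big_split_ord /= [X in _ * (_ * X)]big1 ?mulr1; last first.
    by move=> j _; rewrite /g (unsplitK (inr j)).
  have [xE|ne] := eqVneq (ffun_prefix m l y) x.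
    rewrite big1 ?mulr1 // => j _.
    by rewrite /g (unsplitK (inl j)) -xE ffunE eqxx.
  suff /eqP -> : \prod_(j < m) g (lshift l j) (y (lshift l j)) == 0 by rewrite mulr0.
  apply: contraNT ne => /prodf_neq0 h; apply/eqP/ffunP => j.
  have := h j isT; rewrite /g (unsplitK (inl j)) ffunE.
  by case: (y (lshift l j) =P x j) => //= _; rewrite mulr0n eqxx.
rewrite prod_pmf_expect big_split_ord /= [X in _ * X]big1 ?mulr1; last first.
  move=> j _; rewrite -[RHS]p1; apply: eq_bigr => t _.
  by rewrite /g (unsplitK (inr j)) mulr1.
apply: eq_bigr => j _; rewrite (bigD1 (x j)) //= big1 ?addr0.
  by rewrite /g (unsplitK (inl j)) eqxx mulr1.
by move=> t tx; rewrite /g (unsplitK (inl j)) (negbTE tx) mulr0.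
Qed.

(** An event on the first [m] coordinates is pulled back to a cylinder, which has the same
    probability under the longer product. *)
Lemma dTV_prod_nondecreasing (p q : T -> R) m n : is_pmf p -> is_pmf q -> (m <= n)%N ->
  dTV (prod_pmf p (n:=m)) (prod_pmf q (n:=m))
  <= dTV (prod_pmf p (n:=n)) (prod_pmf q (n:=n)).
Proof.
move=> pP qP /subnKC <-; set l := (n - m)%N.
apply/dTV_leP; split; first exact: dTV_ge0.
move=> A; pose A' := [set y | ffun_prefix m l y \in A].
have E (r : T -> R) : is_pmf r ->
   \sum_(x in A) prod_pmf r x = \sum_(y in A') prod_pmf r (n:=m + l) y.
  move=> rP; rewrite (partition_big (ffun_prefix m l) (mem A)) /=; last first.
    by move=> y; rewrite inE.
  apply: eq_bigr => x xA; rewrite -(prod_pmf_prefix r m l x rP); apply: eq_bigl => y.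
  by rewrite inE andbC; case: eqP => //= ->; rewrite xA.
by rewrite !E //; apply: dTV_ge.
Qed.

(** The sequence is nondecreasing and bounded by 1, so its upper limit is its limit and its
    supremum. *)
Lemma limn_sup_dTV_prod (p q : T -> R) (c : R) : is_pmf p -> is_pmf q ->
  limn_sup (fun n => dTV (prod_pmf p (n:=n)) (prod_pmf q (n:=n))) <= c <->
  forall n, dTV (prod_pmf p (n:=n)) (prod_pmf q (n:=n)) <= c.
Proof.
move=> pP qP; set u := fun n => _.
have und : nondecreasing_seq u by move=> m n mn; apply: dTV_prod_nondecreasing.
have uc : cvgn u.
  apply: nondecreasing_is_cvgn => //; exists 1 => _ [n _ <-].
  by apply: dTV_le1; apply: prod_pmf_pmf.
rewrite cvg_limn_supE //; split=> [h n|h].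
  by apply: le_trans h; apply: (nondecreasing_cvgn_le und uc).
by apply: limr_le => //; apply: nearW.
Qed.

End ProductVariation.

(** * Achievability at every rate above the single-letter information *)

Lemma achievable_single_letter (R : realType) (X Z : finType) (PXZ : X * Z -> R)
    (D : X -> X -> R) (dmax Delta Pi : R) (W : X -> Z -> X -> R) (delta : R) :
  is_pmf PXZ -> (forall x y, 0 <= D x y <= dmax) ->
  (forall x z, is_pmf (W x z)) -> single_exp_dist PXZ W D <= Delta ->
  (forall n, dTV (prod_pmf (margX PXZ) (n:=n)) (prod_pmf (margY PXZ W) (n:=n)) <= Pi) ->
  0 < delta ->
  exists R0, 0 <= R0 /\ achievable true PXZ D (cond_mutinf PXZ W + delta) R0 Delta Pi.
Proof.
move=> PP Db WP Dist Perc delta0.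
have [x0 _] := pmf_pos _ (margX_pmf PXZ PP).
have [V [VP PXZ_V]] := disintegration (fun z x => PXZ (x, z)) x0 (fun z x => proj1 PP (x, z)).
have {}PXZ_V x z : PXZ (x, z) = margZ PXZ z * V z x by apply: PXZ_V.
set I := cond_mutinf PXZ W.
have I0 : 0 <= I := cond_mutinf_ge0 PXZ W PP WP V VP PXZ_V.
have ln2 : 0 < ln 2 :> R by rewrite ln_gt0 // ltr1n.
have dmax0 : 0 <= dmax by case/andP: (Db x0 x0); apply: le_trans.
pose phi x y z := info_density W V x y z.
have jointP : is_pmf (fun t : X * X * Z => single_joint PXZ W t.1.1 t.1.2 t.2).
  split=> [t|]; first exact: single_joint_ge0.
  rewrite (sum_triple (single_joint PXZ W)) -[RHS](sum_PXZ PXZ PP); apply: eq_bigr => x _.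
  by rewrite exchange_big; apply: eq_bigr => z _ /=; rewrite sum_joint_y.
(* Half of the rate margin is spent on the moment bound; the other half remains as the exponent of
   decay. *)
have eta0 : 0 < delta * ln 2 / 2 by rewrite divr_gt0 ?mulr_gt0.
have [s [s01 mgf]] := mgf_bound _ (fun t => phi t.1.1 t.1.2 t.2) _ jointP eta0.
rewrite (sum_triple (fun x y z => single_joint PXZ W x y z * phi x y z)) in mgf.
rewrite (sum_triple (fun x y z => single_joint PXZ W x y z * expR (s * phi x y z))) in mgf.
rewrite /phi -(cond_mutinf_info_density PXZ W PP WP V VP PXZ_V) -/I in mgf.
set E := \sum_x _ in mgf.
have X0 : (0 : R) < #|X|%:R by rewrite ltr0n; apply/card_gt0P; exists x0.
(* Chosen so that [expR (n%:R * (R0 * ln 2))] is the square of [#|X|%:R ^+ n * expR n%:R]; the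
   deviation term [#|X| ^ n / L] is then [2 * expR (- n%:R)]. *)
pose R0 : R := (2 * ln #|X|%:R + 2) / ln 2.
have R00 : 0 <= R0.
  apply: divr_ge0; last exact: ltW.
  have : 0 <= ln #|X|%:R :> R by apply: ln_ge0; rewrite ler1n -(@ltr0n R).
  lra.
exists R0; split=> // eps eps0.
have /andP[s0 s1] := s01.
have eps20 : 0 < eps / 2 by rewrite divr_gt0.
(* The constant 8 is the 4 of [iid_code] times a 2 that pays for rounding [M] down. *)
have [N1 H1] := expR_decay (dmax * 8) (s * (delta * ln 2 / 2)) (eps / 2) (mulr_gt0 s0 eta0) eps20.
have [N2 H2] := expR_decay (dmax * 2) 1 (eps / 2) ltr01 eps20.
(* The 1 excludes the empty block, for which [n%:R^-1 * n%:R] is not 1. *)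
exists (maxn 1 (maxn N1 N2)) => n; rewrite !geq_max => /andP[n0 /andP[n1 n2]].
have nR0 : 0 <= n%:R :> R by rewrite ler0n.
set M := card_rate n (I + delta + eps); set M' := card_rate n (R0 + eps).
have MR : expR (n%:R * ((I + delta) * ln 2)) / 2 <= M%:R.
  apply: le_trans (card_rate_ge_half n _ _); last by lra.
  by rewrite ler_pM2r ?invr_gt0 // ler_expR ler_wpM2l // ler_pM2r // lerDl ltW.
have MR0 : (0 : R) < M%:R by apply: lt_le_trans MR; rewrite divr_gt0 ?expR_gt0.
have M0 : (0 < M)%N by rewrite -(@ltr0n R).
(* The halving gives [L ^+ 2] a factor [1 / 4], below the factor [1 / 2] lost when [M'] is rounded
   down. *)
pose L : R := #|X|%:R ^+ n * expR n%:R / 2.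
have L0 : 0 < L by rewrite divr_gt0 ?mulr_gt0 ?exprn_gt0 ?expR_gt0.
have Xexp : #|X|%:R ^+ n = expR (n%:R * ln #|X|%:R) :> R.
  by rewrite expRM_natl lnK // posrE.
have LM' : L ^+ 2 <= M'%:R.
  apply: le_trans (card_rate_ge_half n _ _); last by rewrite addr_ge0 // ltW.
  have -> : L ^+ 2 = expR (n%:R * (R0 * ln 2)) / 4.
    rewrite /R0 divfK ?gt_eqF // mulrDr (mulrC n%:R 2) !(mulrCA n%:R 2).
    rewrite (_ : 2 * (n%:R * ln #|X|%:R) + 2 * n%:R =
      (n%:R * ln #|X|%:R + n%:R) + (n%:R * ln #|X|%:R + n%:R)); last by ring.
    by rewrite expRD expRD -Xexp /L; field.
  have : expR (n%:R * (R0 * ln 2)) <= expR (n%:R * ((R0 + eps) * ln 2)).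
    by rewrite ler_expR ler_wpM2l // ler_pM2r // lerDl ltW.
  have := expR_gt0 (n%:R * (R0 * ln 2)); lra.
have [f [g [val iid outE dist]]] :=
  iid_code PXZ W D dmax PP WP Db V VP PXZ_V n M M' s L M0 s01 L0 LM'.
exists f, g; split=> //; last first.
  rewrite outE; apply: le_trans (Perc n) _; lra.
apply: le_trans dist _.
rewrite mulVf ?mul1r ?pnatr_eq0 -?lt0n //; apply: lerD => //.
have lnM : n%:R * ((I + delta) * ln 2) - ln 2 <= ln M%:R.
  rewrite -ler_expR lnK ?posrE // expRB lnK ?posrE //.
have E0 : 0 <= E.
  apply: sumr_ge0 => x _; apply: sumr_ge0 => y _; apply: sumr_ge0 => z _.
  by rewrite mulr_ge0 ?expR_ge0 ?single_joint_ge0.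
have t1 : dmax * (4 * (expR (- (s * ln M%:R)) * E ^+ n)) <= eps / 2.
  apply: le_trans (H1 n n1); rewrite -!mulrA; apply: ler_wpM2l => //.
  rewrite (_ : 8 = 4 * 2) -?mulrA; last by rewrite -natrM.
  apply: ler_wpM2l => //.
  have En : E ^+ n <= expR (n%:R * (s * (I * ln 2 + delta * ln 2 / 2))).
    by rewrite expRM_natl lerXn2r // nnegrE ?expR_ge0.
  apply: (@le_trans _ _ (expR (- (s * ln M%:R)) *
      expR (n%:R * (s * (I * ln 2 + delta * ln 2 / 2))))).
    by rewrite ler_pM2l ?expR_gt0.
  rewrite -[X in _ <= X * _](@lnK R 2) ?posrE // -!expRD ler_expR.
  have := ler_wpM2l (ltW s0) lnM.
  have : s * ln 2 <= ln 2 by rewrite ger_pMl.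
  lra.
have t2 : dmax * ((#|X| ^ n)%:R / L) <= eps / 2.
  apply: le_trans (H2 n n2); rewrite -mulrA; apply: ler_wpM2l => //.
  rewrite mulr1 expRN natrX /L le_eqVlt; apply/orP; left; apply/eqP.
  by field; rewrite !gt_eqF ?expR_gt0 ?exprn_gt0.
rewrite mulrDr; move: t1 t2; rewrite /E /phi; lra.
Qed.

(** * Converse *)

Section Converse.
Context {R : realType} {X Z : finType}.
Variable PXZ : X * Z -> R.
Hypothesis PP : is_pmf PXZ.

Section Code.
Variables (n M M' : nat) (f : encoder R X Z n M M') (g : decoder R X Z n M M').
Hypotheses (fgP : valid_code f g) (n0 : (0 < n)%N) (M'0 : (0 < M')%N).
Local Notation XN := {ffun 'I_n -> X}.
Local Notation ZN := {ffun 'I_n -> Z}.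
Local Notation J := (code_joint PXZ f g).

Lemma code_joint_ge0 x z k y : 0 <= J x z k y.
Proof.
have [fP gP] := fgP; rewrite !mulr_ge0 ?invr_ge0 ?ler0n //.
  by apply: prodr_ge0 => i _; case: PP.
by apply: sumr_ge0 => m _; apply: mulr_ge0; [case: (fP x z k)|case: (gP m z k)].
Qed.

Lemma message_exists : (0 < M)%N.
Proof.
have [fP _] := fgP.
have [[x0 z0] _] := pmf_pos _ PP.
have [m _] := pmf_pos _ (fP [ffun=> x0] [ffun=> z0] (Ordinal M'0)).
by apply: leq_ltn_trans (ltn_ord m).
Qed.

Lemma code_joint_marginal (h : XN -> ZN -> R) :
  \sum_(x : XN) \sum_(z : ZN) \sum_k \sum_y J x z k y * h x z =
  \sum_(x : XN) \sum_(z : ZN) (\prod_i PXZ (x i, z i)) * h x z.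
Proof.
have [fP gP] := fgP.
apply: eq_bigr => x _; apply: eq_bigr => z _.
under [LHS]eq_bigr => k _ do rewrite -mulr_suml -mulr_sumr exchange_big /=.
rewrite -mulr_suml; congr (_ * _).
have mass k : \sum_m \sum_y f x z k m * g m z k y = 1.
  rewrite -(proj2 (fP x z k)); apply: eq_bigr => m _.
  by rewrite -mulr_sumr (proj2 (gP m z k)) mulr1.
under [LHS]eq_bigr => k _ do rewrite mass mulr1.
rewrite sumr_const card_ord -[LHS]mulr_natr -mulrA mulVf ?mulr1 //.
by rewrite pnatr_eq0 -lt0n.
Qed.

(** The expected type of the block triple, that is, the law of the letters at a uniformly random
    time. *)
Definition empirical (t : X * X * Z) : R :=
  \sum_(x : XN) \sum_(z : ZN) \sum_k \sum_(y : XN)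
    J x z k y * (n%:R^-1 * \sum_i ((x i, y i, z i) == t)%:R).

Lemma empirical_ge0 t : 0 <= empirical t.
Proof.
do 4!(apply: sumr_ge0 => ? _); rewrite mulr_ge0 ?code_joint_ge0 //.
by rewrite mulr_ge0 ?invr_ge0 ?ler0n // sumr_ge0.
Qed.

Lemma empirical_expect (F : X * X * Z -> R) :
  \sum_t empirical t * F t =
  \sum_(x : XN) \sum_(z : ZN) \sum_k \sum_(y : XN)
    J x z k y * (n%:R^-1 * \sum_i F (x i, y i, z i)).
Proof.
under eq_bigr do rewrite mulr_suml.
rewrite exchange_big; apply: eq_bigr => x _ /=.
under eq_bigr do rewrite mulr_suml.
rewrite exchange_big; apply: eq_bigr => z _ /=.
under eq_bigr do rewrite mulr_suml.
rewrite exchange_big; apply: eq_bigr => k _ /=.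
under eq_bigr do rewrite mulr_suml.
rewrite exchange_big; apply: eq_bigr => y _ /=.
transitivity (\sum_t J x z k y * (n%:R^-1 *
    \sum_i ((x i, y i, z i) == t)%:R * F t)).
  by apply: eq_bigr => t _; rewrite -mulr_suml; ring.
rewrite -mulr_sumr -mulr_sumr exchange_big /=; congr (_ * (_ * _)).
by apply: eq_bigr => i _; rewrite sum_indicator.
Qed.

Lemma average_const (c : R) (F : 'I_n -> R) : (forall i, F i = c) ->
  n%:R^-1 * \sum_i F i = c.
Proof.
move=> Fc; rewrite (eq_bigr (fun=> c)) // sumr_const card_ord -[X in _ * X]mulr_natl.
by rewrite mulrA mulVf ?mul1r // pnatr_eq0 -lt0n.
Qed.

Lemma average_exchange {A B : finType} (p : A -> B -> R) (h : 'I_n -> A -> B -> R) :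
  \sum_a \sum_b p a b * (n%:R^-1 * \sum_i h i a b) =
  n%:R^-1 * \sum_i \sum_a \sum_b p a b * h i a b.
Proof.
rewrite [X in _ = _ * X]exchange_big mulr_sumr; apply: eq_bigr => a _ /=.
rewrite [X in _ = _ * X]exchange_big mulr_sumr; apply: eq_bigr => b _ /=.
by rewrite mulrCA mulr_sumr.
Qed.

Lemma empirical_XZ x z : \sum_y empirical (x, y, z) = PXZ (x, z).
Proof.
have -> : \sum_y empirical (x, y, z) =
    \sum_t empirical t * ((x, z) == (t.1.1, t.2))%:R.
  rewrite (sum_triple (fun a b c => empirical (a, b, c) * ((x, z) == (a, c))%:R)) /=.
  rewrite [RHS]exchange_big; apply: eq_bigr => y _ /=.
  rewrite -[LHS](sum_indicator (fun a => empirical (a, y, z)) x); apply: eq_bigr => a _.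
  rewrite -[in LHS](sum_indicator (fun c => empirical (a, y, c)) z) mulr_sumr; apply: eq_bigr => c _.
  by rewrite xpair_eqE -mulnb natrM mulrA [RHS]mulrC.
rewrite empirical_expect /=.
rewrite (code_joint_marginal (fun x' z' => n%:R^-1 * \sum_i ((x, z) == (x' i, z' i))%:R)).
rewrite (average_exchange (fun (x' : XN) (z' : ZN) => \prod_i PXZ (x' i, z' i))
  (fun i x' z' => ((x, z) == (x' i, z' i))%:R)).
apply: average_const => i.
rewrite (sum_prod_pair_at (fun a c => PXZ (a, c)) i (fun a c => ((x, z) == (a, c))%:R)).
  rewrite pair_big /= -(sum_indicator PXZ (x, z)); apply: eq_bigr => -[a c] _ /=.
  by rewrite mulrC.
exact: sum_PXZ.
Qed.

(** Under the i.i.d. restriction every output letter has the same law, so averaging over time does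
    not change it and the perception constraint survives single-letterisation. *)
Lemma empirical_Y (PYZ : X * Z -> R) : is_pmf PYZ ->
  (forall y z, YZ_dist PXZ f g y z = \prod_i PYZ (y i, z i)) ->
  forall y, \sum_x \sum_z empirical (x, y, z) = \sum_z PYZ (y, z).
Proof.
move=> PYZP YZE y.
have -> : \sum_x \sum_z empirical (x, y, z) =
    \sum_t empirical t * (y == t.1.2)%:R.
  rewrite (sum_triple (fun a b c => empirical (a, b, c) * (y == b)%:R)) /=.
  apply: eq_bigr => x _.
  rewrite -(sum_indicator (fun b => \sum_z empirical (x, b, z)) y).
  by apply: eq_bigr => b _; rewrite mulrC mulr_suml.
rewrite empirical_expect /=.
transitivity (\sum_(y' : XN) \sum_(z : ZN) (\prod_i PYZ (y' i, z i)) *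
    (n%:R^-1 * \sum_i (y == y' i)%:R)).
  rewrite exchange_big [RHS]exchange_big; apply: eq_bigr => z _ /=.
  under [RHS]eq_bigr do rewrite -YZE /YZ_dist mulr_suml.
  rewrite [RHS]exchange_big; apply: eq_bigr => x _ /=.
  under [RHS]eq_bigr do rewrite mulr_suml.
  by rewrite [RHS]exchange_big.
rewrite (average_exchange (fun (y' : XN) (z : ZN) => \prod_i PYZ (y' i, z i))
  (fun i y' z => (y == y' i)%:R)).
apply: average_const => i.
rewrite (sum_prod_pair_at (fun a c => PYZ (a, c)) i (fun a c => (y == a)%:R)).
  rewrite -(sum_indicator (fun a => \sum_z PYZ (a, z)) y); apply: eq_bigr => a _.
  by rewrite mulrC mulr_suml.
exact: sum_PXZ.
Qed.

(* Jensen: [E ln U <= ln E U], and [E U <= M] because the encoder probability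
   of each message is at most 1. *)
Lemma information_le_log_messages (V : X -> X -> Z -> R) :
  (forall x y z, 0 <= V x y z) -> (forall y z, \sum_x V x y z <= 1) ->
  (forall x y z, PXZ (x, z) != 0 -> 0 < V x y z) ->
  \sum_t empirical t * ln (V t.1.1 t.1.2 t.2 * margZ PXZ t.2 / PXZ (t.1.1, t.2))
  <= n%:R^-1 * ln M%:R.
Proof.
move=> V0 V1 Vpos; have [fP gP] := fgP; have M0 := message_exists.
have [P0 _] := PP.
have MR0 : (0 : R) < M%:R by rewrite ltr0n.
rewrite empirical_expect /=.
under eq_bigr do under eq_bigr do under eq_bigr do under eq_bigr do rewrite mulrCA.
under eq_bigr do under eq_bigr do under eq_bigr do rewrite -mulr_sumr.
under eq_bigr do under eq_bigr do rewrite -mulr_sumr.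
under eq_bigr do rewrite -mulr_sumr.
rewrite -mulr_sumr; apply: ler_wpM2l; first by rewrite invr_ge0 ler0n.
pose U (x : XN) (z : ZN) (y : XN) :=
  \prod_i (V (x i) (y i) (z i) * margZ PXZ (z i) / PXZ (x i, z i)).
(* [ln (U / M) <= U / M - 1], the tangent form of Jensen's inequality, on the support of the code
   law. *)
have step x z k y : J x z k y *
    (\sum_i ln (V (x i) (y i) (z i) * margZ PXZ (z i) / PXZ (x i, z i)))
  <= J x z k y * U x z y / M%:R + J x z k y * (ln M%:R - 1).
  rewrite -mulrA -mulrDr.
  have [->|J0] := eqVneq (J x z k y) 0; first by rewrite !mul0r.
  apply: ler_wpM2l; first exact: code_joint_ge0.
  have Pn i : PXZ (x i, z i) != 0.
    move: J0; rewrite /code_joint !mulf_eq0 !negb_or -andbA => /andP[/prodf_neq0 h _].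
    exact: h.
  have pos i : 0 < V (x i) (y i) (z i) * margZ PXZ (z i) / PXZ (x i, z i).
    have p0 : 0 < PXZ (x i, z i) by rewrite lt0r Pn P0.
    rewrite divr_gt0 // mulr_gt0 ?Vpos //.
    by rewrite /margZ (bigD1 (x i)) //= ltr_pwDl // sumr_ge0.
  rewrite -ln_prod // -/(U x z y).
  have U0 : 0 < U x z y by apply: prodr_gt0.
  have := ln_le_sub1 (U x z y / M%:R) (divr_gt0 U0 MR0).
  by rewrite ln_div ?posrE //; lra.
have mass : \sum_(x : XN) \sum_(z : ZN) \sum_k \sum_(y : XN) J x z k y * (ln M%:R - 1) = ln M%:R - 1.
  rewrite (code_joint_marginal (fun _ _ => ln M%:R - 1)).
  under eq_bigr do rewrite -mulr_suml.
  rewrite -mulr_suml (sum2_prod (fun i a c => PXZ (a, c))).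
  by rewrite big1 ?mul1r // => i _; apply: sum_PXZ.
(* The source law cancels the denominators of [U], and [f] is bounded by 1. What remains is summed
   over [x] by subnormalisation of [V], over [y] by that of [g], and over the [M] messages. *)
have EU : \sum_(x : XN) \sum_(z : ZN) \sum_k \sum_(y : XN) J x z k y * U x z y <= M%:R.
  apply: (@le_trans _ _ (\sum_(x : XN) \sum_(z : ZN) \sum_k \sum_(y : XN)
     (\prod_i V (x i) (y i) (z i)) *
     ((\prod_i margZ PXZ (z i)) * (M'%:R^-1 * \sum_m g m z k y)))).
    apply: ler_sum => x _; apply: ler_sum => z _.
    apply: ler_sum => k _; apply: ler_sum => y _.
    have -> : J x z k y * U x z y =
        (\prod_i (V (x i) (y i) (z i) * margZ PXZ (z i) / PXZ (x i, z i) * PXZ (x i, z i)))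
        * (M'%:R^-1 * \sum_m f x z k m * g m z k y).
      by rewrite [in RHS]big_split /= /code_joint /U; ring.
    rewrite mulrA -[X in _ <= X * _]big_split /=.
    (* Cancellation fails only where [PXZ] vanishes; the left side is 0 there, so the inequality
       still holds. *)
    have PV i : 0 <= V (x i) (y i) (z i) * margZ PXZ (z i) / PXZ (x i, z i) * PXZ (x i, z i)
       <= V (x i) (y i) (z i) * margZ PXZ (z i).
      have mZ := margZ_ge0 PXZ PP (z i).
      have VZ := mulr_ge0 (V0 (x i) (y i) (z i)) mZ.
      have [->|Pn] := eqVneq (PXZ (x i, z i)) 0; first by rewrite mulr0 lexx.
      by rewrite divfK // lexx andbT.
    have g0 m : 0 <= g m z k y by case: (gP m z k).
    have f0 m : 0 <= f x z k m by case: (fP x z k).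
    apply: ler_pM.
    - by apply: prodr_ge0 => i _; case/andP: (PV i).
    - by rewrite mulr_ge0 ?invr_ge0 ?ler0n // sumr_ge0 // => m _; rewrite mulr_ge0.
    - exact: ler_prod.
    - rewrite ler_wpM2l ?invr_ge0 ?ler0n //; apply: ler_sum => m _.
      by rewrite -[leRHS]mul1r ler_wpM2r // pmf_le1.
  rewrite exchange_big /=.
  apply: (@le_trans _ _ (\sum_(z : ZN) (\prod_i margZ PXZ (z i)) * M%:R)); last first.
    rewrite -mulr_suml -(bigA_distr_bigA (fun i => margZ PXZ)) big1 ?mul1r // => i _.
    by rewrite -[RHS](sum_PXZ PXZ PP) exchange_big.
  apply: ler_sum => z _.
  have Z0 : 0 <= \prod_i margZ PXZ (z i).
    by apply: prodr_ge0 => i _; apply: margZ_ge0.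
  have -> : M%:R = \sum_(k < M') \sum_(y : XN) M'%:R^-1 * \sum_m g m z k y.
    under eq_bigr => k _.
      rewrite -mulr_sumr exchange_big /=.
      under eq_bigr => m _ do rewrite (proj2 (gP m z k)).
      rewrite sumr_const card_ord; over.
    by rewrite sumr_const card_ord -[RHS]mulr_natl mulrA mulfV ?mul1r // pnatr_eq0 -lt0n.
  rewrite exchange_big mulr_sumr; apply: ler_sum => k _ /=.
  rewrite exchange_big mulr_sumr; apply: ler_sum => y _ /=.
  rewrite -mulr_suml -[leRHS]mul1r; apply: ler_wpM2r.
    rewrite mulr_ge0 // mulr_ge0 ?invr_ge0 ?ler0n // sumr_ge0 // => m _.
    by case: (gP m z k).
  rewrite -(bigA_distr_bigA (fun i a => V a (y i) (z i))).
  apply: (@le_trans _ _ (\prod_(i < n) 1)); last by rewrite big1.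
  apply: ler_prod => i _; rewrite V1 andbT; exact: sumr_ge0.
apply: (@le_trans _ _ (\sum_(x : XN) \sum_(z : ZN) \sum_k \sum_(y : XN)
  (J x z k y * U x z y / M%:R + J x z k y * (ln M%:R - 1)))).
  by do 4!(apply: ler_sum => ? _).
under eq_bigr do under eq_bigr do under eq_bigr do rewrite big_split /= -mulr_suml.
under eq_bigr do under eq_bigr do rewrite big_split /= -mulr_suml.
under eq_bigr do rewrite big_split /= -mulr_suml.
rewrite big_split /= -mulr_suml mass.
have : (\sum_(x : XN) \sum_(z : ZN) \sum_k \sum_(y : XN) J x z k y * U x z y) / M%:R <= 1.
  by rewrite ler_pdivrMr // mul1r.
lra.
Qed.

(** [W] is the conditional law of the output letter under [empirical], whose source marginal is
    [PXZ]. Distortion is linear in [empirical], hence preserved. *)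
Lemma code_single_letter (D : X -> X -> R) : code_iid PXZ f g ->
  exists W : X -> Z -> X -> R, [/\ forall x z, is_pmf (W x z),
    single_exp_dist PXZ W D = exp_dist PXZ D f g,
    out_dist PXZ f g = prod_pmf (margY PXZ W) (n:=n) &
    forall x y z, single_joint PXZ W x y z = empirical (x, y, z)].
Proof.
move=> [PYZ [PYZP YZE]].
have [[x0 _] _] := pmf_pos _ PP.
have [K [KP KE]] := disintegration (fun xz y => empirical (xz.1, y, xz.2)) x0
  (fun xz y => empirical_ge0 (xz.1, y, xz.2)).
have jE x y z : single_joint PXZ (fun x z => K (x, z)) x y z = empirical (x, y, z).
  by rewrite /single_joint (KE (x, z) y) /= empirical_XZ.
exists (fun x z => K (x, z)); split=> //.
- rewrite /single_exp_dist.
  under eq_bigr do under eq_bigr do under eq_bigr do rewrite jE.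
  rewrite -(sum_triple (fun x y z => empirical (x, y, z) * D x y)).
  transitivity (\sum_t empirical t * D t.1.1 t.1.2).
    by apply: eq_bigr => -[[x y] z].
  exact: empirical_expect.
- apply/funext => y; rewrite /out_dist exchange_big /=.
  transitivity (\sum_z YZ_dist PXZ f g y z) => //.
  under eq_bigr do rewrite YZE.
  rewrite -(bigA_distr_bigA (fun i c => PYZ (y i, c))).
  apply: eq_bigr => i _; rewrite -(empirical_Y PYZ PYZP YZE) /margY.
  by apply: eq_bigr => x _; apply: eq_bigr => z _; rewrite jE.
Qed.

End Code.

End Converse.

(** * Passage to the limit *)

Section UltraLimit.
Context {R : realType}.
Local Open Scope classical_set_scope.

(** By compactness of the unit interval, an ultrafilter refining [\oo] gives all coordinates a limit
    at once, with no successive extraction of subsequences. *)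
Lemma bounded_family_ultralimit {T : Type} (w : nat -> T -> R) :
  (forall k t, 0 <= w k t <= 1) ->
  exists G : set_system nat, [/\ ProperFilter G, \oo `<=` G &
    exists a : T -> R, forall t, w k t @[k --> G] --> a t].
Proof.
move=> w01.
have [G [GU Goo]] := ultraFilterLemma (eventually_filter : ProperFilter \oo).
exists G; split=> //; first exact: ultra_proper.
suff /choice [a aP] : forall t, exists l : R, w k t @[k --> G] --> l by exists a.
move=> t.
have GP : ProperFilter G by exact: ultra_proper.
have cpt : compact `[0 : R, 1] by exact: segment_compact.
have G01 : (w^~ t @ G) `[0 : R, 1].
  by apply: (@filterE _ G) => k; rewrite /= in_itv /=.
have [l [_ lP]] := cpt (w^~ t @ G) _ G01; exists l => B lB.
have [//|GnB] := in_ultra_setVsetC (w^~ t @^-1` B) GU.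
by have [x []] := lP (~` B) B GnB lB.
Qed.

Lemma ultralimit_le (G : set_system nat) (u : nat -> R) (l b : R) (m : nat) :
  ProperFilter G -> \oo `<=` G -> u k @[k --> G] --> l ->
  (forall k, (m <= k)%N -> u k <= b + k.+1%:R^-1) -> l <= b.
Proof.
move=> GP Goo ul ub; apply/ler_addgt0Pr => e e0.
rewrite -(cvg_lim (@Rhausdorff R) ul); apply: limr_le; first by apply/cvg_ex; exists l.
apply: Goo; have [k0 k0e] : exists k0 : nat, k0.+1%:R^-1 <= e.
  exists (Num.trunc e^-1); rewrite invf_ple ?posrE ?ltr0n //.
  exact/ltW/truncnS_gt.
exists (maxn m k0) => // k /=; rewrite geq_max => /andP[mk kk].
apply: le_trans (ub k mk) _; rewrite lerD2l; apply: le_trans k0e.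
by rewrite lef_pV2 ?posrE ?ltr0n // ler_nat.
Qed.

Lemma cvg_sum_finite (G : set_system nat) {I : finType} (P : pred I)
    (F : I -> nat -> R) (a : I -> R) :
  Filter G -> (forall i, F i k @[k --> G] --> a i) ->
  \sum_(i | P i) F i k @[k --> G] --> \sum_(i | P i) a i.
Proof. move=> GF h; apply: cvg_big => //; exact: add_continuous. Qed.

Lemma cvg_prod_finite (G : set_system nat) {I : finType}
    (F : I -> nat -> R) (a : I -> R) :
  Filter G -> (forall i, F i k @[k --> G] --> a i) ->
  \prod_i F i k @[k --> G] --> \prod_i a i.
Proof. move=> GF h; apply: cvg_big => //; exact: mul_continuous. Qed.

End UltraLimit.

Section ConverseLimit.
Context {R : realType} {X Z : finType}.
Variables (PXZ : X * Z -> R) (D : X -> X -> R) (Rt R0 Delta Pi : R).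
Hypotheses (PP : is_pmf PXZ) (R00 : 0 <= R0).

(** Strict positivity on the support of the source keeps the arguments of the logarithms in
    [information_functional] positive there. *)
Definition posterior_kernel (V : X -> X -> Z -> R) :=
  [/\ forall x y z, 0 <= V x y z, forall y z, \sum_x V x y z <= 1 &
      forall x y z, PXZ (x, z) != 0 -> 0 < V x y z].

(** A variational form of the conditional information in nats. For fixed [V] it is linear in [W],
    hence continuous, although the information itself involves [W] inside the logarithm. *)
Definition information_functional (W : X -> Z -> X -> R) (V : X -> X -> Z -> R) : R :=
  \sum_x \sum_y \sum_z single_joint PXZ W x y z *
    ln (V x y z * margZ PXZ z / PXZ (x, z)).

Lemma achievable_approx_kernel (k : nat) :
  achievable true PXZ D Rt R0 Delta Pi ->
  exists W : X -> Z -> X -> R, [/\ forall x z, is_pmf (W x z),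
    single_exp_dist PXZ W D <= Delta + k.+1%:R^-1,
    forall m, (m <= k)%N -> dTV (prod_pmf (margX PXZ) (n:=m))
      (prod_pmf (margY PXZ W) (n:=m)) <= Pi + k.+1%:R^-1 &
    forall V, posterior_kernel V ->
      information_functional W V <= Rt * ln 2 + k.+1%:R^-1].
Proof.
set eps := k.+1%:R^-1; have eps0 : 0 < eps by rewrite invr_gt0 ltr0n.
move=> /(_ eps eps0) [N /(_ (maxn N k.+1)) H].
(* A block longer than [k], so that by monotonicity the perception bound of the code covers every
   [m <= k]. *)
set n := maxn N k.+1 in H.
have kn : (k < n)%N by rewrite leq_maxr.
have [f [g [val iid dist perc]]] := H (leq_maxl _ _).
have n0 : (0 < n)%N by apply: leq_trans kn.
have M'0 : (0 < card_rate n (R0 + eps))%N.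
  have : 0 <= R0 + eps by rewrite addr_ge0 // ltW.
  rewrite -(@ltr0n R) => /(card_rate_ge_half n); apply: lt_le_trans.
  by rewrite divr_gt0 ?expR_gt0.
have [W [WP WD WY WJ]] := code_single_letter PXZ PP n _ _ f g val n0 M'0 D (iid isT).
exists W; split=> //; first by rewrite WD.
  move=> m mk; apply: le_trans perc; rewrite WY.
  apply: dTV_prod_nondecreasing; first exact: margX_pmf.
    exact: margY_pmf.
  exact: leq_trans (ltnW kn).
move=> V [V0 V1 Vp].
have -> : information_functional W V = \sum_t empirical PXZ n _ _ f g t *
   ln (V t.1.1 t.1.2 t.2 * margZ PXZ t.2 / PXZ (t.1.1, t.2)).
  rewrite /information_functional -sum_triple.
  by apply: eq_bigr => -[[x y] z] _ /=; rewrite WJ.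
apply: le_trans (information_le_log_messages PXZ PP n _ _ f g val M'0 V V0 V1 Vp) _.
set M := card_rate n (Rt + eps).
have M0 : (0 < M)%N by apply: (message_exists PXZ PP n _ _ f g val M'0).
have ln2 : 0 < ln 2 :> R by rewrite ln_gt0 // ltr1n.
have lnM : ln M%:R <= n%:R * (Rt + eps) * ln 2 :> R.
  rewrite -ler_expR lnK ?posrE ?ltr0n //.
  have := @truncn_le R (2 `^ (n%:R * (Rt + eps))).
  rewrite powR_ge0 -/(card_rate _ _) -/M /powR pnatr_eq0 /= => /idP; apply.
rewrite ler_pdivrMl ?ltr0n //; apply: le_trans lnM _.
rewrite -mulrA; apply: ler_wpM2l; first by rewrite ler0n.
(* The slack [eps * ln 2] is absorbed into [eps] because [ln 2 <= 1]. *)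
rewrite mulrDl lerD2l ger_pMr //.
have : ln 2 <= 2 - 1 :> R by exact: ln_le_sub1.
lra.
Qed.

Lemma achievable_kernel : achievable true PXZ D Rt R0 Delta Pi ->
  exists W : X -> Z -> X -> R, [/\ forall x z, is_pmf (W x z),
    single_exp_dist PXZ W D <= Delta,
    forall m, dTV (prod_pmf (margX PXZ) (n:=m)) (prod_pmf (margY PXZ W) (n:=m)) <= Pi &
    forall V, posterior_kernel V -> information_functional W V <= Rt * ln 2].
Proof.
move=> ach.
have [W_ WP] := choice (fun k => achievable_approx_kernel k ach).
have W01 k (t : X * Z * X) : 0 <= W_ k t.1.1 t.1.2 t.2 <= 1.
  have [P _ _ _] := WP k; rewrite (proj1 (P _ _)) /=; exact: pmf_le1.
have [G [GP Goo [a aP]]] := bounded_family_ultralimit (fun k t => W_ k t.1.1 t.1.2 t.2) W01.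
pose W x z y := a (x, z, y).
have Wc x z y : (W_ k x z y @[k --> G] --> W x z y)%classic by exact: (aP (x, z, y)).
have Jc x y z : (single_joint PXZ (W_ k) x y z @[k --> G]
    --> single_joint PXZ W x y z)%classic.
  by apply: cvgM; [exact: cvg_cst|exact: Wc].
have Yc y : (margY PXZ (W_ k) y @[k --> G] --> margY PXZ W y)%classic.
  by apply: cvg_sum_finite => x; apply: cvg_sum_finite => z; apply: Jc.
have inv0 k : 0 <= k.+1%:R^-1 :> R by rewrite invr_ge0 ler0n.
exists W; split=> [x z||m|V VP].
- split=> [y|].
    rewrite -oppr_le0; apply: (ultralimit_le G (fun k => - W_ k x z y) _ _ 0 GP Goo).
      by apply: cvgN; apply: Wc.
    move=> k _; have [P _ _ _] := WP k.
    by rewrite add0r (le_trans _ (inv0 k)) // oppr_le0 (proj1 (P x z)).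
  have Sc : (\sum_y W_ k x z y @[k --> G] --> \sum_y W x z y)%classic.
    by apply: cvg_sum_finite => y; apply: Wc.
  have S1 k : \sum_y W_ k x z y = 1 by have [P _ _ _] := WP k; have [] := P x z.
  rewrite -(cvg_lim (@Rhausdorff R) Sc).
  by under eq_fun do rewrite S1; rewrite lim_cst.
- apply: (ultralimit_le G (fun k => single_exp_dist PXZ (W_ k) D) _ _ 0 GP Goo).
    do 3!(apply: cvg_sum_finite => ?); apply: cvgM; [exact: Jc|exact: cvg_cst].
  by move=> k _; have [] := WP k.
(* Each event is tested separately: for fixed [m] its probability is a finite sum of finite
   products, and the bound holds once [k >= m]. *)
- apply/dTV_leP; split.
    apply: (ultralimit_le G (fun=> 0) _ _ 0 GP Goo); first exact: cvg_cst.
    move=> k _; have [_ _ P _] := WP k.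
    by apply: le_trans (P 0%N _) => //; apply: dTV_ge0.
  move=> A; apply: (ultralimit_le G (fun k => `|\sum_(x in A) prod_pmf (margX PXZ) x
     - \sum_(x in A) prod_pmf (margY PXZ (W_ k)) x|) _ _ m GP Goo).
    apply: cvg_norm; apply: cvgB; first exact: cvg_cst.
    by apply: cvg_sum_finite => x; apply: cvg_prod_finite => i; apply: Yc.
  move=> k mk; have [_ _ P _] := WP k.
  by apply: le_trans (P m mk); apply: dTV_ge.
- apply: (ultralimit_le G (fun k => information_functional (W_ k) V) _ _ 0 GP Goo).
    do 3!(apply: cvg_sum_finite => ?); apply: cvgM; [exact: Jc|exact: cvg_cst].
  by move=> k _; have [_ _ _] := WP k; apply.
Qed.

(** At the true posterior [K] of the input letter given output and side information, the functional
    is the information itself. [K] may vanish on the support of the source, so an admissible kernel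
    close to it is used. *)
Lemma cond_mutinf_le_rate (W : X -> Z -> X -> R) :
  (forall x z, is_pmf (W x z)) ->
  (forall V, posterior_kernel V -> information_functional W V <= Rt * ln 2) ->
  cond_mutinf PXZ W <= Rt.
Proof.
move=> WP info.
have ln2 : 0 < ln 2 :> R by rewrite ln_gt0 // ltr1n.
have [[x0 z0] _] := pmf_pos _ PP.
have [V [VP VE]] := disintegration (fun z x => PXZ (x, z)) x0 (fun z x => proj1 PP (x, z)).
have {}VE x z : PXZ (x, z) = margZ PXZ z * V z x by apply: VE.
have J0 := single_joint_ge0 PXZ W PP WP.
have [K [KP KE]] := disintegration (fun yz x => single_joint PXZ W x yz.1 yz.2) x0
  (fun yz x => J0 x yz.1 yz.2).
have JK x y z : single_joint PXZ W x y z = margZ PXZ z * reverse_output W V z y * K (y, z) x.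
  by rewrite (KE (y, z) x) /= (sum_joint_x PXZ W V VE).
rewrite -(ler_pM2r ln2) (cond_mutinf_info_density PXZ W PP WP V VP VE).
set I := \sum_x _.
rewrite leNgt; apply/negP => lt.
(* Half of the supposed gap, so that a loss of [e] still leaves the functional above [Rt * ln 2]. *)
pose e := (I - Rt * ln 2) / 2.
have e0 : 0 < e by rewrite divr_gt0 // subr_gt0.
pose c := expR (- e).
have c0 : 0 < c by apply: expR_gt0.
have c1 : c < 1 by rewrite /c -expR0 ltr_expR oppr_lt0.
(* Mixing in [P(x|z)] keeps the posterior kernel positive, at a cost of [- ln c = e]. *)
pose Vc x y z := c * K (y, z) x + (1 - c) * V z x.
have c1' : 0 < 1 - c by rewrite subr_gt0.
have K0 y z x : 0 <= K (y, z) x by case: (KP (y, z)).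
have V0 z x : 0 <= V z x by case: (VP z).
have VcP : posterior_kernel Vc.
  split=> [x y z|y z|x y z Pn].
  - by rewrite addr_ge0 // mulr_ge0 // ltW.
  - rewrite big_split /= -mulr_sumr -mulr_sumr (proj2 (KP _)) (proj2 (VP z)).
    lra.
  - rewrite ltr_wpDl ?mulr_ge0 ?(ltW c0) // mulr_gt0 // lt0r V0 andbT.
    by move: Pn; rewrite VE mulf_eq0 negb_or => /andP[].
have := info Vc VcP.
suff : - e + I <= information_functional W Vc by rewrite /e; lra.
have mass : \sum_x \sum_y \sum_z single_joint PXZ W x y z = 1.
  rewrite -[RHS](sum_PXZ PXZ PP); apply: eq_bigr => x _; rewrite exchange_big.
  by apply: eq_bigr => z _; apply: sum_joint_y.
have -> : - e + I = \sum_x \sum_y \sum_z single_joint PXZ W x y z *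
    (- e + info_density W V x y z).
  rewrite -[X in X + _]mul1r -mass mulr_suml -big_split; apply: eq_bigr => x _ /=.
  rewrite mulr_suml -big_split; apply: eq_bigr => y _ /=.
  rewrite mulr_suml -big_split; apply: eq_bigr => z _ /=.
  by rewrite mulrDr.
apply: ler_sum => x _; apply: ler_sum => y _; apply: ler_sum => z _.
have [->|Jn] := eqVneq (single_joint PXZ W x y z) 0; first by rewrite !mul0r.
apply: ler_wpM2l; first exact: J0.
have [zp vp wp qp] := joint_neq0 PXZ W PP WP V VP VE x y z Jn.
have Pp : 0 < PXZ (x, z) by rewrite VE mulr_gt0.
have -> : - e + info_density W V x y z = ln (c * (W x z y / reverse_output W V z y)).
  by rewrite lnM ?posrE ?divr_gt0 // /c expRK.
rewrite ler_ln ?posrE.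
(* Bayes' rule: the density of the output given the input equals that of the posterior against the
   prior. *)
- have -> : W x z y / reverse_output W V z y = K (y, z) x * margZ PXZ z / PXZ (x, z).
    have JE := JK x y z; rewrite /single_joint in JE.
    apply/eqP; rewrite eqr_div ?lt0r_neq0 //; apply/eqP.
    by rewrite mulrC JE; ring.
  rewrite mulrA mulrA ler_wpM2r ?invr_ge0 ?(ltW Pp) // ler_wpM2r ?(ltW zp) //.
  by rewrite lerDl mulr_ge0 // ltW.
- by rewrite mulr_gt0 // divr_gt0.
- have [_ _ Vcp] := VcP.
  by rewrite divr_gt0 // mulr_gt0 // Vcp // gt_eqF.
Qed.

End ConverseLimit.

(** * Comparison of the operational and single-letter infima *)

Theorem theorem4 (R : realType) (X Z : finType) (PXZ : X * Z -> R)
  (D : X -> X -> R) (dmax : R) (Delta Pi : R) :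
  is_pmf PXZ ->
  (forall x y, 0 <= D x y <= dmax) ->
  ((Rs false PXZ D Delta Pi <= RDP_single PXZ D Delta Pi)%E /\
   Rs true PXZ D Delta Pi = RDP_single PXZ D Delta Pi).
Proof.
move=> PP Db.
(* Codes of the restricted kind are codes, so the unrestricted infimum runs over a larger set of
   rates. *)
have restr_le : (Rs false PXZ D Delta Pi <= Rs true PXZ D Delta Pi)%E.
  apply: ereal_inf_le_tmp => _ [r [R0 [R00 ach]] <-]; exists r => //.
  exists R0; split=> // eps eps0; have [N H] := ach eps eps0.
  exists N => n nN; have [f [g [? ? ? ?]]] := H n nN.
  by exists f, g; split.
have ach_le : (Rs true PXZ D Delta Pi <= RDP_single PXZ D Delta Pi)%E.
  apply: le_ereal_inf_tmp => _ [W [WP dist perc] <-].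
  have YP := margY_pmf PXZ W PP WP.
  have percn := proj1 (limn_sup_dTV_prod _ _ _ (margX_pmf PXZ PP) YP) perc.
  apply/lee_addgt0Pr => delta delta0.
  have [R0 ach] := achievable_single_letter R X Z PXZ D dmax Delta Pi W delta PP Db WP
    dist percn delta0.
  by apply: ereal_inf_lbound; exists (cond_mutinf PXZ W + delta) => //; exists R0.
split; first exact: le_trans ach_le.
apply/eqP; rewrite eq_le ach_le /=.
apply: le_ereal_inf_tmp => _ [r [R0 [R00 ach]] <-].
have [W [WP dist percn info]] := achievable_kernel PXZ D r R0 Delta Pi PP R00 ach.
apply: (@le_trans _ _ (cond_mutinf PXZ W)%:E); last first.
  by rewrite lee_fin; apply: cond_mutinf_le_rate.
apply: ereal_inf_lbound; exists W => //; split=> //.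
apply/(limn_sup_dTV_prod _ _ _ (margX_pmf PXZ PP)) => //.
exact: margY_pmf.
Qed.
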